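(* Let $f$ satisfy (f1) and suppose $f_0=0$ and $f_\infty=0$. Then there exists $\lambda_*^+>0$ such that for every $\lambda\in(\lambda_*^+,+\infty)$ problem (MO) has two solutions $u_1^+,u_2^+$ which are positive and strictly concave in $(0,1)$. Similarly, there exists $\lambda_*^->0$ such that for every $\lambda\in(\lambda_*^-,+\infty)$ problem (MO) has two solutions $u_1^-,u_2^-$ which are negative and strictly convex in $(0,1)$.
   Context: Let $N\ge 1$ be an integer and $f:\mathbb{R}\to\mathbb{R}$ continuous. For $\lambda\ge 0$, problem (MO) is: find $u\in C^2[0,1]$ with $\left((u'(r))^N\right)'=\lambda^N N r^{N-1} f(-u(r))$ for $0<r<1$ and $u'(0)=u(1)=0$. Condition (f1): $f\in C(\mathbb{R},\mathbb{R})$ and $f(s)s^N>0$ for all $s\neq0$. The quantities $f_0,f_\infty\in[0,+\infty]$ are defined by $f_0^N=\lim_{s\to0} f(s)/s^N$ and $f_\infty^N=\lim_{|s|\to+\infty} f(s)/s^N$ (limits assumed to exist in $[0,+\infty]$). *)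

(* Defs.v *)
From Stdlib Require Import Reals Lra.
Open Scope R_scope.

Definition f_zero_at_0 (N : nat) (f : R -> R) : Prop :=
  forall eps, eps > 0 -> exists delta, delta > 0 /\
    forall s, s <> 0 -> Rabs s < delta -> Rabs (f s / s ^ N) < eps.

Definition f_zero_at_infty (N : nat) (f : R -> R) : Prop :=
  forall eps, eps > 0 -> exists M, M > 0 /\
    forall s, Rabs s > M -> Rabs (f s / s ^ N) < eps.

Definition cond_f1 (N : nat) (f : R -> R) : Prop :=
  continuity f /\ forall s, s <> 0 -> f s * s ^ N > 0.

(* u is a solution of (MO): u in C^2[0,1] (represented by a C^2 function on R,
   equivalently by extension), ((u')^N)' = lam^N N r^(N-1) f(-u(r)) on (0,1),
   u'(0) = u(1) = 0. *)
Definition solves_MO (N : nat) (f : R -> R) (lam : R) (u : R -> R) : Prop :=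
  exists u1 u2 : R -> R,
    (forall x, derivable_pt_lim u x (u1 x)) /\
    (forall x, derivable_pt_lim u1 x (u2 x)) /\
    continuity u2 /\
    (forall r, 0 < r < 1 ->
       derivable_pt_lim (fun s => (u1 s) ^ N) r
         (lam ^ N * INR N * r ^ (N - 1) * f (- u r))) /\
    u1 0 = 0 /\ u 1 = 0.

Definition positive_on_01 (u : R -> R) : Prop :=
  forall r, 0 < r < 1 -> u r > 0.

Definition negative_on_01 (u : R -> R) : Prop :=
  forall r, 0 < r < 1 -> u r < 0.

Definition strictly_concave_on_01 (u : R -> R) : Prop :=
  forall x y t, 0 < x < 1 -> 0 < y < 1 -> x <> y -> 0 < t < 1 ->
    u (t * x + (1 - t) * y) > t * u x + (1 - t) * u y.

Definition strictly_convex_on_01 (u : R -> R) : Prop :=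
  forall x y t, 0 < x < 1 -> 0 < y < 1 -> x <> y -> 0 < t < 1 ->
    u (t * x + (1 - t) * y) < t * u x + (1 - t) * u y.

Definition distinct_on_01 (u v : R -> R) : Prop :=
  exists x, 0 <= x <= 1 /\ u x <> v x.

(* Main.v *)
(* Up to sign, a solution is a decreasing function v with v(1) = 0 and
     v(r) = v(0) - lam * int_0^r (int_0^s N t^(N-1) g(v(t)) dt)^(1/N) ds,
   where g > 0 on (0, +oo) and g(s) = o(s^N) both at 0 and at +oo.  We shoot from
   v(0) = d.  Since g is only continuous the equation need not determine v, so g(v(t))
   is replaced by g(v(t - 1/n)): the delayed equation is solved step by step and its
   solution depends continuously on d.  For d small or d large, g(s) = o(s^N) forces
   v(1) > 0, whereas for d = 1 concavity gives v(1) < 0 as soon as lam is large, uniformly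
   in n.  The intermediate value theorem yields delayed solutions with v(1) = 0 on either
   side of d = 1; they are equi-Lipschitz, so they have uniform limit points, which solve
   the undelayed equation.  The d = 1 estimate also holds in the limit, so the two limits
   start strictly on opposite sides of 1. *)
Require Import Defs.
From Stdlib Require Import Reals Lra Lia Classical ClassicalEpsilon.
From Coquelicot Require Import Coquelicot.
Open Scope R_scope.

(** * Powers, [N]-th roots and their modulus of continuity *)

Lemma pow_superadditive (N : nat) (a b : R) :
  (1 <= N)%nat -> 0 <= a -> 0 <= b -> a ^ N + b ^ N <= (a + b) ^ N.
Proof.
intros HN Ha Hb; induction HN as [|n Hn IH]; [lra|].
simpl.
assert (0 <= a ^ n) by now apply pow_le.
assert (0 <= b ^ n) by now apply pow_le.
apply Rle_trans with ((a + b) * (a ^ n + b ^ n)); [nra|].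
apply Rmult_le_compat_l; lra.
Qed.

(** Extended by 0 to negative arguments, so that it is monotone and continuous on the whole line. *)
Definition root (N : nat) (x : R) : R :=
  if Rle_dec x 0 then 0 else Rpower x (/ INR N).

Lemma root_nonneg (N : nat) (x : R) : 0 <= root N x.
Proof.
unfold root; destruct (Rle_dec x 0); [lra|].
left; apply exp_pos.
Qed.

Lemma root_pos (N : nat) (x : R) : 0 < x -> 0 < root N x.
Proof.
intros Hx; unfold root; destruct (Rle_dec x 0); [lra|].
apply exp_pos.
Qed.

Lemma root_pow (N : nat) (x : R) : (1 <= N)%nat -> 0 <= x -> root N x ^ N = x.
Proof.
intros HN Hx; unfold root; destruct (Rle_dec x 0).
- rewrite pow_i; [lra|lia].
- rewrite <- Rpower_pow by apply exp_pos.
  rewrite Rpower_mult, Rinv_l, Rpower_1; try lra.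
  apply not_0_INR; lia.
Qed.

Lemma pow_le_reg (N : nat) (a b : R) :
  (1 <= N)%nat -> 0 <= b -> a ^ N <= b ^ N -> a <= b.
Proof.
intros HN Hb H; destruct (Rle_or_lt a b) as [|Hlt]; [assumption|].
exfalso; apply (Rlt_irrefl (b ^ N)).
apply Rlt_le_trans with (a ^ N); [|assumption].
apply Rlt_le_trans with (b ^ N + (a - b) ^ N).
- assert (0 < (a - b) ^ N) by (apply pow_lt; lra); lra.
- replace (a ^ N) with ((b + (a - b)) ^ N) by (f_equal; ring).
  apply pow_superadditive; [assumption|lra|lra].
Qed.

Lemma pow_inj (N : nat) (a b : R) :
  (1 <= N)%nat -> 0 <= a -> 0 <= b -> a ^ N = b ^ N -> a = b.
Proof.
intros HN Ha Hb H; apply Rle_antisym; apply (pow_le_reg N); auto; lra.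
Qed.

Lemma root_le (N : nat) (x y : R) : (1 <= N)%nat -> x <= y -> root N x <= root N y.
Proof.
intros HN Hxy; destruct (Rle_or_lt x 0).
- replace (root N x) with 0; [apply root_nonneg|].
  unfold root; destruct (Rle_dec x 0); lra.
- apply (pow_le_reg N); auto using root_nonneg.
  rewrite !root_pow; auto; lra.
Qed.

Lemma root_mult_pow (N : nat) (x y : R) :
  (1 <= N)%nat -> 0 <= x -> 0 <= y -> root N (x ^ N * y) = x * root N y.
Proof.
intros HN Hx Hy; apply (pow_inj N); auto using root_nonneg.
- apply Rmult_le_pos; auto using root_nonneg.
- rewrite Rpow_mult_distr, !root_pow; auto.
  apply Rmult_le_pos; auto using pow_le.
Qed.

(** Superadditivity of the power gives subadditivity of the root. The resulting modulus [e ^ N] is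
    uniform in the base point, including 0, where the root need not be Lipschitz. *)
Lemma root_dist (N : nat) (x y e : R) :
  (1 <= N)%nat -> 0 <= e -> Rabs (x - y) <= e ^ N -> Rabs (root N x - root N y) <= e.
Proof.
intros HN He.
assert (main : forall x y, x <= y -> y - x <= e ^ N -> root N y <= root N x + e).
{ clear x y; intros x y Hxy H.
  apply (pow_le_reg N); auto.
  { assert (0 <= root N x) by apply root_nonneg; lra. }
  apply Rle_trans with (root N x ^ N + e ^ N);
    [|apply pow_superadditive; auto using root_nonneg].
  destruct (Rle_or_lt y 0).
  - replace (root N y) with 0 by (unfold root; destruct (Rle_dec y 0); lra).
    rewrite pow_i by lia.
    assert (0 <= root N x ^ N) by (apply pow_le, root_nonneg); lra.
  - rewrite (root_pow N y) by (auto; lra).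
    destruct (Rle_or_lt x 0).
    + assert (0 <= root N x ^ N) by (apply pow_le, root_nonneg).
      replace (root N x) with 0 in * by (unfold root; destruct (Rle_dec x 0); lra).
      rewrite pow_i by lia.
      destruct (Rle_or_lt 0 x); [lra|lra].
    + rewrite root_pow by (auto; lra); lra. }
intros H; destruct (Rle_or_lt x y) as [Hxy|Hxy].
- rewrite Rabs_left1 in H by lra.
  assert (root N y <= root N x + e) by (apply main; lra).
  assert (root N x <= root N y) by now apply root_le.
  rewrite Rabs_left1; lra.
- rewrite Rabs_right in H by lra.
  assert (root N x <= root N y + e) by (apply main; lra).
  assert (root N y <= root N x) by (apply root_le; auto; lra).
  rewrite Rabs_right; lra.
Qed.

(** * Continuity in epsilon-delta form, and clamping to an interval *)

Lemma continuous_intro (f : R -> R) (x : R) :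
  (forall e, 0 < e -> exists d, 0 < d /\ forall y, Rabs (y - x) < d -> Rabs (f y - f x) < e) ->
  continuous f x.
Proof.
intros H; apply continuity_pt_filterlim; intros e He.
destruct (H e He) as [d [Hd H']]; exists d; split; [exact Hd|].
intros y [_ Hy]; apply H', Hy.
Qed.

Lemma continuous_elim (f : R -> R) (x e : R) :
  continuous f x -> 0 < e ->
  exists d, 0 < d /\ forall y, Rabs (y - x) < d -> Rabs (f y - f x) < e.
Proof.
intros H He; apply continuity_pt_filterlim in H.
destruct (H e He) as [d [Hd H']]; exists d; split; [exact Hd|].
intros y Hy; destruct (Req_dec x y) as [<-|Hne].
- rewrite Rminus_diag, Rabs_R0; exact He.
- apply H'; split; [split; [exact I|exact Hne]|exact Hy].
Qed.

Lemma continuous_root (N : nat) (x : R) : (1 <= N)%nat -> continuous (root N) x.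
Proof.
intros HN; apply continuous_intro; intros e He.
exists ((e / 2) ^ N); split; [apply pow_lt; lra|].
intros y Hy; apply Rle_lt_trans with (e / 2); [|lra].
apply root_dist; auto; lra.
Qed.

Lemma eq_of_small (x y : R) : (forall e, 0 < e -> Rabs (x - y) <= e) -> x = y.
Proof.
intros H; destruct (Req_dec x y) as [|Hne]; [assumption|exfalso].
assert (Hp : 0 < Rabs (x - y)) by (apply Rabs_pos_lt; lra).
specialize (H (Rabs (x - y) / 2)); lra.
Qed.

(** The nearest-point projection onto [[0, D]]. It serves to truncate the nonlinearity and to extend
    functions from [[0, 1]] to the line. *)
Definition clamp (D x : R) : R := Rmin (Rmax x 0) D.

Lemma clamp_range (D x : R) : 0 <= D -> 0 <= clamp D x <= D.
Proof.
intros; unfold clamp, Rmin, Rmax; repeat destruct Rle_dec; lra.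
Qed.

Lemma clamp_id (D x : R) : 0 <= x <= D -> clamp D x = x.
Proof.
intros; unfold clamp, Rmin, Rmax; repeat destruct Rle_dec; lra.
Qed.

Lemma clamp_dist (D x y : R) : Rabs (clamp D x - clamp D y) <= Rabs (x - y).
Proof.
unfold clamp, Rmin, Rmax; repeat destruct Rle_dec;
  unfold Rabs; repeat destruct Rcase_abs; lra.
Qed.

Lemma continuous_lip (f : R -> R) (L x : R) :
  (forall y, Rabs (f y - f x) <= L * Rabs (y - x)) -> continuous f x.
Proof.
intros H; apply continuous_intro; intros e He.
assert (HL : 0 < Rabs L + 1) by (assert (0 <= Rabs L) by apply Rabs_pos; lra).
exists (e / (Rabs L + 1)); split; [now apply Rdiv_lt_0_compat|].
intros y Hy.
apply Rle_lt_trans with (1 := H y).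
apply Rle_lt_trans with ((Rabs L + 1) * Rabs (y - x)).
- apply Rmult_le_compat_r; [apply Rabs_pos|]. assert (L <= Rabs L) by apply Rle_abs; lra.
- apply Rmult_lt_compat_l with (r := Rabs L + 1) in Hy; [|exact HL].
  replace ((Rabs L + 1) * (e / (Rabs L + 1))) with e in Hy by (field; lra); exact Hy.
Qed.

Lemma continuous_clamp (D x : R) : continuous (clamp D) x.
Proof.
apply (continuous_lip _ 1); intros y; rewrite Rmult_1_l; apply clamp_dist.
Qed.

(** * Compactness of equi-Lipschitz sequences *)

(** Subsequences are represented by infinite index sets, so that refining is taking subsets. *)
Definition infinite (A : nat -> Prop) : Prop := forall n0, exists n, (n0 <= n)%nat /\ A n.

Definition within (F : nat -> R -> R) (A : nat -> Prop) (x e : R) : Prop :=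
  forall n m, A n -> A m -> Rabs (F n x - F m x) <= e.

(** Pigeonhole: the range of values is cut into pieces of length [e]. Either the lowest piece
    receives infinitely many indices, or infinitely many remain above it and one piece fewer is
    left. *)
Lemma refine_at_point (F : nat -> R -> R) (B x e : R) (A : nat -> Prop) :
  infinite A -> (forall n, Rabs (F n x) <= B) -> 0 < e ->
  exists A', infinite A' /\ (forall n, A' n -> A n) /\ within F A' x e.
Proof.
intros HS HB He.
assert (main : forall k a A, infinite A -> (forall n, A n -> a <= F n x <= a + INR k * e) ->
  exists A', infinite A' /\ (forall n, A' n -> A n) /\ within F A' x e).
{ clear A HS; induction k as [|k IH]; intros a A HS Hr.
  - exists A; split; [exact HS|split; [tauto|]].
    intros n m Hn Hm; apply Hr in Hn; apply Hr in Hm; simpl in *.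
    apply Rabs_le; lra.
  - destruct (classic (infinite (fun n => A n /\ F n x <= a + e))) as [Hi|Hi].
    + exists (fun n => A n /\ F n x <= a + e); split; [exact Hi|split; [tauto|]].
      intros n m [Hn Hn'] [Hm Hm']; apply Hr in Hn; apply Hr in Hm.
      apply Rabs_le; lra.
    + destruct (IH (a + e) (fun n => A n /\ a + e < F n x)) as [A' [H1 [H2 H3]]].
      * intros n0; apply not_all_ex_not in Hi; destruct Hi as [n1 Hn1].
        destruct (HS (max n0 n1)) as [n [Hn HSn]].
        exists n; split; [lia|split; [exact HSn|]].
        destruct (Rle_or_lt (F n x) (a + e)); [|assumption].
        exfalso; apply Hn1; exists n; split; [lia|tauto].
      * intros n [Hn Hn']; apply Hr in Hn; rewrite S_INR in Hn; lra.
      * exists A'; split; [exact H1|split; [|exact H3]]; intros n Hn; now apply H2. }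
destruct (nfloor_ex (Rmax (2 * B / e) 0)) as [k [_ Hk]]; [apply Rmax_r|].
apply (main (k + 1)%nat (- B) A HS).
intros n _; specialize (HB n); apply Rabs_le_between in HB; split; [lra|].
rewrite plus_INR; simpl.
assert (H : 2 * B / e < INR k + 1) by (eapply Rle_lt_trans; [apply Rmax_l|exact Hk]).
apply Rmult_lt_compat_r with (r := e) in H; [|exact He].
replace (2 * B / e * e) with (2 * B) in H by (field; lra); lra.
Qed.

(** The sequence is refined to precision [e / 2] at each point of a grid of mesh [1 / m] with
    [4 * L <= m * e]. Moving from [x] to the grid then costs at most [e / 4] for each of the two
    functions. *)
Lemma refine_uniformly (F : nat -> R -> R) (B L e : R) (A : nat -> Prop) :
  (forall n x, 0 <= x <= 1 -> Rabs (F n x) <= B) ->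
  (forall n x y, 0 <= x <= 1 -> 0 <= y <= 1 -> Rabs (F n x - F n y) <= L * Rabs (x - y)) ->
  infinite A -> 0 < e ->
  exists A', infinite A' /\ (forall n, A' n -> A n) /\
    forall x, 0 <= x <= 1 -> within F A' x e.
Proof.
intros HB HL HS He.
destruct (nfloor_ex (Rmax (4 * L / e) 0)) as [k [_ Hk]]; [apply Rmax_r|].
set (m := S k).
assert (Hm : 0 < INR m) by (apply lt_0_INR; unfold m; lia).
assert (HLm : 4 * L <= INR m * e).
{ assert (H : 4 * L / e < INR m)
    by (unfold m; rewrite S_INR; eapply Rle_lt_trans; [apply Rmax_l|exact Hk]).
  apply Rmult_lt_compat_r with (r := e) in H; [|exact He].
  replace (4 * L / e * e) with (4 * L) in H by (field; lra); lra. }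
assert (main : forall j, (j <= m)%nat -> exists A', infinite A' /\ (forall n, A' n -> A n) /\
  forall i, (i <= j)%nat -> within F A' (INR i / INR m) (e / 2)).
{ assert (Hgrid : forall i, (i <= m)%nat -> 0 <= INR i / INR m <= 1).
  { intros i Hi; apply le_INR in Hi; split.
    - apply Rmult_le_pos; [apply pos_INR|left; now apply Rinv_0_lt_compat].
    - apply Rmult_le_reg_r with (INR m); [exact Hm|].
      replace (INR i / INR m * INR m) with (INR i) by (field; lra); lra. }
  induction j as [|j IH]; intros Hj.
  - destruct (refine_at_point F B (INR 0 / INR m) (e / 2) A HS) as [A' [H1 [H2 H3]]];
      [intros n; now apply HB, Hgrid|lra|].
    exists A'; split; [exact H1|split; [exact H2|]].
    intros i Hi; replace i with 0%nat by lia; exact H3.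
  - destruct IH as [A1 [H1 [H2 H3]]]; [lia|].
    destruct (refine_at_point F B (INR (S j) / INR m) (e / 2) A1 H1) as [A' [H4 [H5 H6]]];
      [intros n; now apply HB, Hgrid|lra|].
    exists A'; split; [exact H4|split; [intros n Hn; apply H2, H5, Hn|]].
    intros i Hi; destruct (Nat.eq_dec i (S j)) as [->|Hne]; [exact H6|].
    intros n p Hn Hp; apply H3; [lia|now apply H5|now apply H5]. }
destruct (main m (le_n m)) as [A' [H1 [H2 H3]]].
exists A'; split; [exact H1|split; [exact H2|]].
intros x Hx n p Hn Hp.
destruct (nfloor_ex (x * INR m)) as [i [Hi1 Hi2]]; [apply Rmult_le_pos; lra|].
assert (Him : (i <= m)%nat) by (apply INR_le; nra).
assert (Hd : Rabs (x - INR i / INR m) <= / INR m).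
{ assert (Hi : 0 <= x - INR i / INR m < / INR m); [|rewrite Rabs_right; lra].
  split.
  - apply Rmult_le_reg_r with (INR m); [exact Hm|].
    replace ((x - INR i / INR m) * INR m) with (x * INR m - INR i) by (field; lra); lra.
  - apply Rmult_lt_reg_r with (INR m); [exact Hm|].
    replace ((x - INR i / INR m) * INR m) with (x * INR m - INR i) by (field; lra).
    rewrite Rinv_l; lra. }
assert (Hy : 0 <= INR i / INR m <= 1).
{ apply le_INR in Him; split.
  - apply Rmult_le_pos; [apply pos_INR|left; now apply Rinv_0_lt_compat].
  - apply Rmult_le_reg_r with (INR m); [exact Hm|].
    replace (INR i / INR m * INR m) with (INR i) by (field; lra); lra. }
assert (HL0 : L * Rabs (x - INR i / INR m) <= e / 4).
{ apply Rle_trans with (Rmax L 0 * / INR m).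
  - apply Rmult_le_compat; [| |apply Rmax_l|exact Hd]; [|apply Rabs_pos].
    (* The Lipschitz bound between 0 and 1 forces [L] to be nonnegative. *)
    specialize (HL 0%nat 0 1 ltac:(lra) ltac:(lra)).
    assert (0 <= Rabs (F 0%nat 0 - F 0%nat 1)) by apply Rabs_pos.
    replace (Rabs (0 - 1)) with 1 in HL by (rewrite Rabs_left; lra); lra.
  - apply Rmult_le_reg_r with (INR m); [exact Hm|].
    rewrite Rmult_assoc, Rinv_l by lra.
    unfold Rmax; destruct Rle_dec; nra. }
assert (E1 := HL n x _ Hx Hy); assert (E2 := HL p x _ Hx Hy).
assert (E3 := H3 i Him n p Hn Hp).
revert E1 E2 E3 HL0; generalize (L * Rabs (x - INR i / INR m)); intros z.
unfold Rabs; repeat destruct Rcase_abs; lra.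
Qed.

(** The Arzela-Ascoli theorem by diagonal extraction, with the limit described as a uniform cluster
    point: functions [F n] with arbitrarily large [n] come arbitrarily close. *)
Lemma cluster_function (F : nat -> R -> R) (B L : R) :
  (forall n x, 0 <= x <= 1 -> Rabs (F n x) <= B) ->
  (forall n x y, 0 <= x <= 1 -> 0 <= y <= 1 -> Rabs (F n x - F n y) <= L * Rabs (x - y)) ->
  exists v : R -> R, forall e n0, 0 < e ->
    exists n, (n0 <= n)%nat /\ forall x, 0 <= x <= 1 -> Rabs (F n x - v x) <= e.
Proof.
intros HB HL.
set (T := {A : nat -> Prop | infinite A}).
assert (step : forall (k : nat) (A : T), exists A' : T,
  (forall n, proj1_sig A' n -> proj1_sig A n) /\
  forall x, 0 <= x <= 1 -> within F (proj1_sig A') x (/ INR (S k))).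
{ intros k [A HS].
  destruct (refine_uniformly F B L (/ INR (S k)) A HB HL HS) as [A' [H1 H2]].
  - apply Rinv_0_lt_compat, lt_0_INR; lia.
  - exists (exist _ A' H1); exact H2. }
assert (HT : infinite (fun _ => True)) by (intros n0; exists n0; auto).
set (next := fun k A => proj1_sig (constructive_indefinite_description _ (step k A))).
set (Sq := fix Sq (k : nat) : T :=
  match k with O => exist _ _ HT | S k' => next k' (Sq k') end).
assert (Hnext : forall k, (forall n, proj1_sig (Sq (S k)) n -> proj1_sig (Sq k) n) /\
  forall x, 0 <= x <= 1 -> within F (proj1_sig (Sq (S k))) x (/ INR (S k))).
{ intros k; exact (proj2_sig (constructive_indefinite_description _ (step k (Sq k)))). }
assert (Hmono : forall j k n, (j <= k)%nat -> proj1_sig (Sq k) n -> proj1_sig (Sq j) n).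
{ intros j k n Hjk; induction Hjk as [|k Hjk IH]; [tauto|].
  intros H; apply IH, Hnext, H. }
assert (Hpick : forall k, exists n, (k <= n)%nat /\ proj1_sig (Sq k) n)
  by (intros k; apply (proj2_sig (Sq k))).
(* The diagonal sequence: [phi k] lies in the [k]-th nested set and is at least [k]. *)
set (phi := fun k => proj1_sig (constructive_indefinite_description _ (Hpick k))).
assert (Hphi : forall k, (k <= phi k)%nat /\ proj1_sig (Sq k) (phi k))
  by (intros k; exact (proj2_sig (constructive_indefinite_description _ (Hpick k)))).
assert (Hc : forall x k p q, 0 <= x <= 1 -> (S k <= p)%nat -> (S k <= q)%nat ->
  Rabs (F (phi p) x - F (phi q) x) <= / INR (S k)).
{ intros x k p q Hx Hp Hq; apply (Hnext k); [exact Hx| |].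
  - apply (Hmono _ p); [exact Hp|apply Hphi].
  - apply (Hmono _ q); [exact Hq|apply Hphi]. }
assert (Harch : forall e, 0 < e -> exists k, / INR (S k) < e).
{ intros e He; destruct (archimed_cor1 e He) as [[|k] [Hk Hk0]]; [lia|now exists k]. }
assert (Hlim : forall x, exists l : R, 0 <= x <= 1 -> is_lim_seq (fun k => F (phi k) x) l).
{ intros x; destruct (classic (0 <= x <= 1)) as [Hx|Hx]; [|exists 0; tauto].
  assert (Hcv : ex_finite_lim_seq (fun k => F (phi k) x)).
  { apply ex_lim_seq_cauchy_corr; intros e.
    destruct (Harch e (cond_pos e)) as [k Hk].
    exists (S k); intros p q Hp Hq.
    apply Rle_lt_trans with (2 := Hk); now apply Hc. }
  destruct Hcv as [l Hl]; now exists l. }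
set (v := fun x => proj1_sig (constructive_indefinite_description _ (Hlim x))).
assert (Hv : forall x, 0 <= x <= 1 -> is_lim_seq (fun k => F (phi k) x) (v x))
  by (intros x; exact (proj2_sig (constructive_indefinite_description _ (Hlim x)))).
exists v; intros e n0 He.
destruct (Harch e He) as [k Hk].
set (p := max n0 (S k)).
exists (phi p); split; [destruct (Hphi p); unfold p in *; lia|].
intros x Hx.
(* With [p] fixed, letting [q] tend to infinity in the Cauchy bound makes the convergence uniform in
   [x]. *)
assert (Hl : is_lim_seq (fun q => Rabs (F (phi p) x - F (phi q) x)) (Rabs (F (phi p) x - v x))).
{ apply (is_lim_seq_abs _ (Finite (F (phi p) x - v x))).
  apply is_lim_seq_minus'; [apply is_lim_seq_const|now apply Hv]. }
apply (is_lim_seq_le_loc _ (fun _ => e) (Rabs (F (phi p) x - v x)) e) in Hl; [exact Hl| |apply is_lim_seq_const].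
exists (S k); intros q Hq; apply Rle_trans with (/ INR (S k)); [|lra].
apply Hc; auto; unfold p; lia.
Qed.

(** * The integral operator *)

(** For a solution [v] without delay, taken as [w], [lam ^ N * mass] is the [N]-th power of [- v'],
    [lam * slope] is [- v'], and [lam * drop] is [v 0 - v r]. *)
Definition mass (N : nat) (G w : R -> R) (s : R) : R :=
  RInt (fun t => INR N * t ^ (N - 1) * G (w t)) 0 s.

Definition slope (N : nat) (G w : R -> R) (s : R) : R := root N (mass N G w s).

Definition drop (N : nat) (G w : R -> R) (r : R) : R := RInt (slope N G w) 0 r.

Lemma is_derive_RInt_cont (f : R -> R) (a x : R) :
  (forall y, continuous f y) -> is_derive (RInt f a) x (f x).
Proof.
intros Hf; apply (is_derive_RInt f (RInt f a) a x); [|apply Hf].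
apply filter_forall; intros y; apply (@RInt_correct R_CompleteNormedModule), ex_RInt_continuous; intros; apply Hf.
Qed.

Lemma is_derive_continuous (f : R -> R) (x l : R) : is_derive f x l -> continuous f x.
Proof. intros H; apply (ex_derive_continuous (V := R_NormedModule)); now exists l. Qed.

Lemma is_derive_weight (N : nat) (x : R) :
  is_derive (fun t => t ^ N) x (INR N * x ^ (N - 1)).
Proof.
apply is_derive_Reals; replace (N - 1)%nat with (pred N) by lia; apply derivable_pt_lim_pow.
Qed.

Lemma continuous_weight (N : nat) (x : R) : continuous (fun t => INR N * t ^ (N - 1)) x.
Proof.
apply (continuous_scal_r (K := R_AbsRing) (V := R_NormedModule)).
eapply is_derive_continuous, is_derive_weight.
Qed.

Lemma weight_nonneg (N : nat) (t : R) : 0 <= t -> 0 <= INR N * t ^ (N - 1).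
Proof. intros Ht; apply Rmult_le_pos; [apply pos_INR|now apply pow_le]. Qed.

(** The weight is the derivative of [t ^ N]. Hence a bound [m] on [G] becomes [m * s ^ N] for [mass]
    and [s * root N m] for [slope]. *)
Lemma RInt_weight (N : nat) (c a b : R) :
  RInt (fun t => INR N * t ^ (N - 1) * c) a b = c * (b ^ N - a ^ N).
Proof.
apply is_RInt_unique.
apply is_RInt_ext with (f := fun t => scal c (INR N * t ^ (N - 1))).
{ intros x _; unfold scal; simpl; unfold mult; simpl; ring. }
apply (is_RInt_scal (V := R_NormedModule)).
apply (is_RInt_derive (V := R_CompleteNormedModule) (fun t => t ^ N)).
- intros; apply is_derive_weight.
- intros; apply continuous_weight.
Qed.

Section Operator.

Variables (N : nat) (G : R -> R).
Hypothesis HN : (1 <= N)%nat.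
Hypothesis G_cont : forall x, continuous G x.
Hypothesis G_nonneg : forall x, 0 <= G x.

Lemma continuous_density (w : R -> R) (x : R) :
  (forall y, continuous w y) -> continuous (fun t => INR N * t ^ (N - 1) * G (w t)) x.
Proof.
intros Hw; apply (continuous_mult (K := R_AbsRing)); [apply continuous_weight|].
apply continuous_comp; [apply Hw|apply G_cont].
Qed.

Lemma ex_RInt_density (w : R -> R) (a b : R) :
  (forall y, continuous w y) -> ex_RInt (fun t => INR N * t ^ (N - 1) * G (w t)) a b.
Proof.
intros Hw; apply (ex_RInt_continuous (V := R_CompleteNormedModule)); intros; now apply continuous_density.
Qed.

Lemma ex_RInt_weight (c a b : R) : ex_RInt (fun t => INR N * t ^ (N - 1) * c) a b.
Proof.
apply (ex_RInt_continuous (V := R_CompleteNormedModule)); intros.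
apply (continuous_mult (K := R_AbsRing)); [apply continuous_weight|apply continuous_const].
Qed.

Lemma mass_derive (w : R -> R) (s : R) :
  (forall y, continuous w y) -> is_derive (mass N G w) s (INR N * s ^ (N - 1) * G (w s)).
Proof.
intros Hw.
apply (is_derive_RInt_cont (fun t => INR N * t ^ (N - 1) * G (w t)) 0 s).
intros; now apply continuous_density.
Qed.

Lemma slope_continuous (w : R -> R) (s : R) :
  (forall y, continuous w y) -> continuous (slope N G w) s.
Proof.
intros Hw; apply (continuous_comp (mass N G w) (root N)).
- eapply is_derive_continuous, mass_derive, Hw.
- now apply continuous_root.
Qed.

Lemma drop_derive (w : R -> R) (r : R) :
  (forall y, continuous w y) -> is_derive (drop N G w) r (slope N G w r).
Proof.
intros Hw; apply is_derive_RInt_cont; intros; now apply slope_continuous.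
Qed.

Lemma drop_0 (w : R -> R) : drop N G w 0 = 0.
Proof. unfold drop; apply (RInt_point (V := R_CompleteNormedModule)). Qed.

Lemma mass_0 (w : R -> R) : mass N G w 0 = 0.
Proof. unfold mass; apply (RInt_point (V := R_CompleteNormedModule)). Qed.

Lemma slope_0 (w : R -> R) : slope N G w 0 = 0.
Proof.
unfold slope, root; rewrite mass_0; destruct Rle_dec; lra.
Qed.

Lemma mass_lower (w : R -> R) (m s : R) :
  (forall y, continuous w y) -> 0 <= s -> (forall t, 0 < t < s -> m <= G (w t)) ->
  m * s ^ N <= mass N G w s.
Proof.
intros Hw Hs H.
replace (m * s ^ N) with (m * (s ^ N - 0 ^ N)) by (rewrite pow_i by lia; ring).
rewrite <- RInt_weight; apply RInt_le; auto using ex_RInt_weight, ex_RInt_density.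
intros t Ht; apply Rmult_le_compat_l; [apply weight_nonneg; lra|auto].
Qed.

Lemma mass_upper (w : R -> R) (m s : R) :
  (forall y, continuous w y) -> 0 <= s -> (forall t, 0 < t < s -> G (w t) <= m) ->
  mass N G w s <= m * s ^ N.
Proof.
intros Hw Hs H.
replace (m * s ^ N) with (m * (s ^ N - 0 ^ N)) by (rewrite pow_i by lia; ring).
rewrite <- RInt_weight; apply RInt_le; auto using ex_RInt_weight, ex_RInt_density.
intros t Ht; apply Rmult_le_compat_l; [apply weight_nonneg; lra|auto].
Qed.

Lemma mass_mono (w : R -> R) (a b : R) :
  (forall y, continuous w y) -> 0 <= a <= b -> mass N G w a <= mass N G w b.
Proof.
intros Hw Hab; unfold mass.
rewrite <- (RInt_Chasles (V := R_CompleteNormedModule) _ 0 a b)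
  by now apply ex_RInt_density.
unfold plus; simpl.
assert (0 <= RInt (fun t => INR N * t ^ (N - 1) * G (w t)) a b); [|lra].
apply RInt_ge_0; [lra|now apply ex_RInt_density|].
intros x Hx; apply Rmult_le_pos; [apply weight_nonneg; lra|auto].
Qed.

Lemma slope_mono (w : R -> R) (a b : R) :
  (forall y, continuous w y) -> 0 <= a <= b -> slope N G w a <= slope N G w b.
Proof. intros; apply root_le; auto; now apply mass_mono. Qed.

Lemma slope_upper (w : R -> R) (m s : R) :
  (forall y, continuous w y) -> 0 <= s -> 0 <= m -> (forall t, 0 < t < s -> G (w t) <= m) ->
  slope N G w s <= s * root N m.
Proof.
intros; rewrite <- root_mult_pow by auto; apply root_le; auto.
rewrite Rmult_comm; now apply mass_upper.
Qed.

Lemma slope_lower (w : R -> R) (m s : R) :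
  (forall y, continuous w y) -> 0 <= s -> 0 <= m -> (forall t, 0 < t < s -> m <= G (w t)) ->
  s * root N m <= slope N G w s.
Proof.
intros; rewrite <- root_mult_pow by auto; apply root_le; auto.
rewrite Rmult_comm; now apply mass_lower.
Qed.

(** Mean value theorem with a monotone derivative. This is the form in which concavity of solutions
    enters the estimates below. *)
Lemma drop_increment (w : R -> R) (a b : R) :
  (forall y, continuous w y) -> 0 <= a <= b ->
  (b - a) * slope N G w a <= drop N G w b - drop N G w a <= (b - a) * slope N G w b.
Proof.
intros Hw Hab.
destruct (MVT_gen (drop N G w) a b (slope N G w)) as [c [Hc Heq]].
- intros x _; now apply drop_derive.
- intros x _; apply continuity_pt_filterlim.
  eapply is_derive_continuous, drop_derive, Hw.
- rewrite Rmin_left, Rmax_right in Hc by lra.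
  rewrite Heq, (Rmult_comm (slope N G w c)).
  split; apply Rmult_le_compat_l; try lra; apply slope_mono; auto; lra.
Qed.

(** Causality: the operator looks only at the past, which is what allows the delayed equation to be
    solved step by step. *)
Lemma drop_local (v w : R -> R) (a r : R) :
  (forall t, 0 <= t <= a -> v t = w t) -> 0 <= r <= a -> drop N G v r = drop N G w r.
Proof.
intros H Hr; apply (RInt_ext (V := R_CompleteNormedModule)).
intros s Hs; rewrite Rmin_left, Rmax_right in Hs by lra.
unfold slope; f_equal; apply (RInt_ext (V := R_CompleteNormedModule)).
intros t Ht; rewrite Rmin_left, Rmax_right in Ht by lra.
rewrite H; [reflexivity|lra].
Qed.

(** An error [e ^ N] in [G] gives at most [e ^ N * s ^ N <= e ^ N] in [mass], hence [e] in [slope]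
    by the modulus of the root, and [e] again after integration over a length at most 1. *)
Lemma drop_close (eta e : R) (v w : R -> R) :
  (forall y, continuous v y) -> (forall y, continuous w y) -> 0 <= e ->
  (forall x y, Rabs (x - y) < eta -> Rabs (G x - G y) <= e ^ N) ->
  (forall t, 0 <= t <= 1 -> Rabs (v t - w t) < eta) ->
  forall r, 0 <= r <= 1 -> Rabs (drop N G v r - drop N G w r) <= e.
Proof.
intros Hv Hw He HG Hvw r Hr.
assert (Hs : forall s, 0 <= s <= 1 -> Rabs (slope N G v s - slope N G w s) <= e).
{ intros s Hs; apply root_dist; auto.
  unfold mass.
  rewrite <- (RInt_minus (V := R_CompleteNormedModule)) by now apply ex_RInt_density.
  apply Rle_trans with (RInt (fun t => INR N * t ^ (N - 1) * (e ^ N)) 0 s).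
  - eapply Rle_trans; [apply abs_RInt_le; [lra|]|].
    { apply (ex_RInt_minus (V := R_CompleteNormedModule)); now apply ex_RInt_density. }
    apply RInt_le; [lra| |apply ex_RInt_weight|].
    { apply ex_RInt_norm, (ex_RInt_minus (V := R_CompleteNormedModule));
        now apply ex_RInt_density. }
    intros t Ht; unfold minus, plus, opp; simpl.
    replace (_ + _) with (INR N * t ^ (N - 1) * (G (v t) - G (w t))) by ring.
    rewrite Rabs_mult, Rabs_right by (apply Rle_ge, weight_nonneg; lra).
    apply Rmult_le_compat_l; [apply weight_nonneg; lra|].
    apply HG, Hvw; lra.
  - rewrite RInt_weight, pow_i by lia.
    assert (s ^ N <= 1) by (rewrite <- (pow1 N); apply pow_incr; lra).
    assert (0 <= e ^ N) by now apply pow_le.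
    nra. }
unfold drop.
assert (Hex : forall u a b, (forall y, continuous u y) -> ex_RInt (slope N G u) a b).
{ intros; apply (ex_RInt_continuous (V := R_CompleteNormedModule)); intros; now apply slope_continuous. }
rewrite <- (RInt_minus (V := R_CompleteNormedModule)) by auto.
apply Rle_trans with ((r - 0) * e); [|nra].
apply abs_RInt_le_const; [lra| |].
- apply (ex_RInt_minus (V := R_CompleteNormedModule)); auto.
- intros t Ht; apply Hs; lra.
Qed.

End Operator.

(** * Delayed equations *)

(** Before time [delta] the initial value [v 0] serves as history. With [delta = 0] nothing changes
    on [[0, 1]], so one notion of solution covers the delayed equations and their limit. *)
Definition delay (delta : R) (v : R -> R) (t : R) : R := v (Rmax (t - delta) 0).

Definition delayed_solution (N : nat) (G : R -> R) (lam delta : R) (v : R -> R) : Prop :=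
  (forall x, continuous v x) /\
  forall r, 0 <= r <= 1 -> v r = v 0 - lam * drop N G (delay delta v) r.

Fixpoint iterate (N : nat) (G : R -> R) (lam delta d : R) (k : nat) : R -> R :=
  match k with
  | O => fun _ => d
  | S k => fun r => d - lam * drop N G (delay delta (iterate N G lam delta d k)) r
  end.

Lemma Rmax_shift_range (delta t : R) : 0 <= delta -> 0 <= t <= 1 -> 0 <= Rmax (t - delta) 0 <= t.
Proof. intros; unfold Rmax; destruct Rle_dec; lra. Qed.

Lemma continuous_delay (delta : R) (v : R -> R) (x : R) :
  (forall y, continuous v y) -> continuous (delay delta v) x.
Proof.
intros Hv; apply (continuous_comp (fun t => Rmax (t - delta) 0) v); [|apply Hv].
apply (continuous_lip _ 1); intros y; unfold Rmax; repeat destruct Rle_dec;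
  unfold Rabs; repeat destruct Rcase_abs; lra.
Qed.

Section Delayed.

Variables (N : nat) (G : R -> R).
Hypothesis HN : (1 <= N)%nat.
Hypothesis G_cont : forall x, continuous G x.
Hypothesis G_nonneg : forall x, 0 <= G x.
Hypothesis G_unif : forall e, 0 < e ->
  exists eta, 0 < eta /\ forall x y, Rabs (x - y) < eta -> Rabs (G x - G y) <= e.

Variable lam : R.
Hypothesis lam_pos : 0 < lam.

Lemma continuous_step (d : R) (w : R -> R) (x : R) :
  (forall y, continuous w y) -> continuous (fun r => d - lam * drop N G w r) x.
Proof.
intros Hw; apply (continuous_minus (V := R_NormedModule)); [apply continuous_const|].
apply (continuous_scal_r (K := R_AbsRing) (V := R_NormedModule)).
eapply is_derive_continuous, drop_derive; auto.
Qed.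

Lemma iterate_continuous (delta d : R) (k : nat) (x : R) :
  continuous (iterate N G lam delta d k) x.
Proof.
revert x; induction k as [|k IH]; intros x; [apply continuous_const|].
apply continuous_step; intros; now apply continuous_delay.
Qed.

(** Method of steps: the right-hand side on [[0, (k + 1) * delta]] only reads values on
    [[0, k * delta]], so each iteration extends by [delta] the interval on which the iterates have
    settled. *)
Lemma iterate_stable (delta d : R) (k : nat) (r : R) :
  0 < delta -> 0 <= r <= INR k * delta ->
  iterate N G lam delta d (S k) r = iterate N G lam delta d k r.
Proof.
intros Hd; revert r; induction k as [|k IH]; intros r Hr.
- simpl in Hr; replace r with 0 by lra; simpl; rewrite drop_0; ring.
- rewrite S_INR in Hr.
  change (d - lam * drop N G (delay delta (iterate N G lam delta d (S k))) r =
    d - lam * drop N G (delay delta (iterate N G lam delta d k)) r).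
  do 2 f_equal; apply (drop_local N G _ _ r); [|lra].
  intros t Ht; apply IH.
  assert (0 <= INR k) by apply pos_INR.
  unfold Rmax; destruct Rle_dec; nra.
Qed.

(** Each iteration is continuous for the uniform norm on [[0, 1]], and only finitely many are
    composed. This makes shooting by the intermediate value theorem possible. *)
Lemma iterate_continuous_data (delta d0 : R) (k : nat) (e : R) :
  0 <= delta -> 0 < e -> exists eta, 0 < eta /\ forall d, Rabs (d - d0) < eta ->
    forall r, 0 <= r <= 1 ->
      Rabs (iterate N G lam delta d k r - iterate N G lam delta d0 k r) < e.
Proof.
intros Hdelta; revert e; induction k as [|k IH]; intros e He.
- exists e; split; [exact He|]; intros d Hd r _; exact Hd.
(* Half of [e] pays for the change of [d], the other half for [lam] times the change of [drop]. *)
- set (e' := e / 2 / lam).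
  assert (He' : 0 < e') by (unfold e'; apply Rdiv_lt_0_compat; lra).
  destruct (G_unif (e' ^ N)) as [eta1 [H1 H1']]; [now apply pow_lt|].
  destruct (IH eta1 H1) as [eta2 [H2 H2']].
  exists (Rmin eta2 (e / 2)); split; [apply Rmin_pos; lra|].
  intros d Hd r Hr; simpl.
  assert (Hd2 := Rlt_le_trans _ _ _ Hd (Rmin_l _ _)).
  assert (Hd3 := Rlt_le_trans _ _ _ Hd (Rmin_r _ _)).
  set (w1 := delay delta (iterate N G lam delta d k)).
  set (w0 := delay delta (iterate N G lam delta d0 k)).
  assert (Hc : Rabs (drop N G w1 r - drop N G w0 r) <= e').
  { apply (drop_close N G HN G_cont eta1); auto.
    - intros; apply continuous_delay; apply iterate_continuous.
    - intros; apply continuous_delay; apply iterate_continuous.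
    - lra.
    - intros t Ht; apply H2'; auto.
      assert (0 <= Rmax (t - delta) 0 <= t) by now apply Rmax_shift_range.
      lra. }
  replace (_ - _) with ((d - d0) - lam * (drop N G w1 r - drop N G w0 r)) by ring.
  apply Rle_lt_trans with (Rabs (d - d0) + lam * e').
  + eapply Rle_trans; [apply Rabs_triang|].
    rewrite Rabs_Ropp, Rabs_mult, (Rabs_right lam) by lra.
    assert (lam * Rabs (drop N G w1 r - drop N G w0 r) <= lam * e')
      by (apply Rmult_le_compat_l; lra).
    lra.
  + replace (lam * e') with (e / 2) by (unfold e'; field; lra); lra.
Qed.

(** With delay [1 / n], exactly [n] steps cover [[0, 1]]. *)
Lemma iterate_delayed_solution (d : R) (n : nat) :
  (1 <= n)%nat -> delayed_solution N G lam (/ INR n) (iterate N G lam (/ INR n) d n) /\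
  iterate N G lam (/ INR n) d n 0 = d.
Proof.
intros Hn.
assert (Hn' : 0 < INR n) by (apply lt_0_INR; lia).
assert (H0 : iterate N G lam (/ INR n) d n 0 = d).
{ destruct n; [lia|]; simpl iterate; rewrite drop_0; ring. }
split; [split|exact H0].
- intros; apply iterate_continuous.
- intros r Hr; rewrite H0, <- iterate_stable; [reflexivity|now apply Rinv_0_lt_compat|].
  rewrite Rinv_r; lra.
Qed.

Section Estimates.

Variables (delta : R) (v : R -> R).
Hypothesis delta_nonneg : 0 <= delta.
Hypothesis Hv : delayed_solution N G lam delta v.

Lemma delay_continuous (x : R) : continuous (delay delta v) x.
Proof. apply continuous_delay, Hv. Qed.

Lemma solution_increment (a b : R) : 0 <= a <= b -> b <= 1 ->
  lam * ((b - a) * slope N G (delay delta v) a) <= v a - v b <=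
  lam * ((b - a) * slope N G (delay delta v) b).
Proof.
intros Hab Hb; destruct Hv as [_ Hv'].
rewrite (Hv' a), (Hv' b) by lra.
destruct (drop_increment N G HN G_cont G_nonneg _ a b delay_continuous Hab) as [H1 H2].
apply Rmult_le_compat_l with (r := lam) in H1; [|lra].
apply Rmult_le_compat_l with (r := lam) in H2; [|lra].
lra.
Qed.

Lemma solution_decreasing (a b : R) : 0 <= a <= b -> b <= 1 -> v b <= v a.
Proof.
intros Hab Hb; destruct (solution_increment a b Hab Hb) as [H _].
assert (0 <= slope N G (delay delta v) a) by apply root_nonneg.
assert (0 <= lam * ((b - a) * slope N G (delay delta v) a)); [|lra].
repeat apply Rmult_le_pos; lra.
Qed.

Lemma delay_le_start (t : R) : 0 <= t <= 1 -> delay delta v t <= v 0.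
Proof.
intros Ht; assert (0 <= Rmax (t - delta) 0 <= t) by now apply Rmax_shift_range.
apply solution_decreasing; lra.
Qed.

Lemma delay_ge (t : R) : 0 <= t <= 1 -> v t <= delay delta v t.
Proof.
intros Ht; assert (0 <= Rmax (t - delta) 0 <= t) by now apply Rmax_shift_range.
apply solution_decreasing; lra.
Qed.

(** The slope on [[0, 1]] is at most [root N M]. The constant depends neither on [delta] nor on [v],
    which gives equicontinuity as the delay shrinks. *)
Lemma solution_lipschitz (M : R) : (forall x, G x <= M) ->
  forall x y, 0 <= x <= 1 -> 0 <= y <= 1 ->
    Rabs (v x - v y) <= lam * root N M * Rabs (x - y).
Proof.
intros HM.
assert (HM0 : 0 <= M) by (eapply Rle_trans; [apply (G_nonneg 0)|apply HM]).
assert (main : forall a b, 0 <= a <= b -> b <= 1 -> v a - v b <= lam * root N M * (b - a)).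
{ intros a b Hab Hb; destruct (solution_increment a b Hab Hb) as [_ H].
  apply Rle_trans with (1 := H).
  assert (slope N G (delay delta v) b <= b * root N M)
    by (apply slope_upper; auto using delay_continuous; lra).
  assert (0 <= root N M) by apply root_nonneg.
  replace (lam * root N M * (b - a)) with (lam * ((b - a) * root N M)) by ring.
  apply Rmult_le_compat_l; [lra|]; apply Rmult_le_compat_l; [lra|]; nra. }
intros x y Hx Hy; destruct (Rle_or_lt x y).
- assert (v x - v y <= lam * root N M * (y - x)) by (apply main; lra).
  assert (v y <= v x) by (apply solution_decreasing; lra).
  rewrite Rabs_right, Rabs_left1 by lra; lra.
- assert (v y - v x <= lam * root N M * (x - y)) by (apply main; lra).
  assert (v x <= v y) by (apply solution_decreasing; lra).
  rewrite Rabs_left1, Rabs_right by lra; lra.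
Qed.

(** All delayed values are at most [v 0], so the total fall is at most [lam * root N K]; the last
    hypothesis is the [N]-th power of [lam * root N K < v 0]. *)
Lemma solution_end_pos (K : R) :
  0 < v 0 -> (forall s, s <= v 0 -> G s <= K) -> lam ^ N * K < v 0 ^ N -> 0 < v 1.
Proof.
intros Hv0 HK Hlt.
assert (HK0 : 0 <= K) by (eapply Rle_trans; [apply (G_nonneg (v 0))|apply HK; lra]).
destruct (solution_increment 0 1) as [_ H]; [lra|lra|].
assert (Hs : slope N G (delay delta v) 1 <= 1 * root N K).
{ apply slope_upper; auto using delay_continuous; [lra|].
  intros t Ht; apply HK, delay_le_start; lra. }
assert (Hr : lam * root N K < v 0).
{ destruct (Rlt_or_le (lam * root N K) (v 0)) as [|Hle]; [assumption|exfalso].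
  assert (Hp := pow_incr (v 0) (lam * root N K) N ltac:(lra)).
  rewrite Rpow_mult_distr, root_pow in Hp; auto; lra. }
apply Rmult_le_compat_l with (r := lam) in Hs; [|lra].
lra.
Qed.

(* If v(1) >= 0, concavity keeps v above 1/2 on [0,1/2], which makes the slope
   on [1/2,1] too steep. *)
Lemma solution_end_neg (m : R) :
  v 0 = 1 -> 0 < m -> (forall s, / 2 <= s <= 1 -> m <= G s) -> 4 < lam * root N m -> v 1 < 0.
Proof.
intros Hv0 Hm HmG Hlam; destruct (Rlt_or_le (v 1) 0) as [|H1]; [assumption|exfalso].
destruct (solution_increment 0 (/2)) as [_ Ha]; [lra|lra|].
destruct (solution_increment (/2) 1) as [Hb _]; [lra|lra|].
assert (Hs : / 2 * root N m <= slope N G (delay delta v) (/ 2)).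
{ apply slope_lower; auto using delay_continuous; try lra.
  intros t Ht; apply HmG.
  assert (v t <= delay delta v t) by (apply delay_ge; lra).
  assert (delay delta v t <= v 0) by (apply delay_le_start; lra).
  assert (v (/ 2) <= v t) by (apply solution_decreasing; lra).
  lra. }
(* Origin of the factor 4: a length [1 / 2] times a slope of at least [root N m / 2] makes the fall
   on [[1/2, 1]] exceed 1, although [v] stays between 0 and 1. *)
apply Rmult_le_compat_l with (r := lam) in Hs; [|lra].
assert (v (/ 2) <= v 0) by (apply solution_decreasing; lra).
lra.
Qed.

End Estimates.

(** The sign condition is a product so that the lemma applies both below 1, where the end value goes
    from positive to negative, and above 1, where it goes back. *)
Lemma delayed_shooting (a b : R) (n : nat) :
  (1 <= n)%nat -> a <= b ->
  (forall v w, delayed_solution N G lam (/ INR n) v -> v 0 = a ->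
    delayed_solution N G lam (/ INR n) w -> w 0 = b -> v 1 * w 1 <= 0) ->
  exists v, delayed_solution N G lam (/ INR n) v /\ a <= v 0 <= b /\ v 1 = 0.
Proof.
intros Hn Hab Hsgn.
assert (Hn' : 0 < / INR n) by (apply Rinv_0_lt_compat, lt_0_INR; lia).
set (V := fun d => iterate N G lam (/ INR n) d n).
assert (HV : forall d, delayed_solution N G lam (/ INR n) (V d) /\ V d 0 = d)
  by (intros d; now apply iterate_delayed_solution).
destruct (IVT_cor (fun d => V d 1) a b) as [d [Hd H0]]; [|exact Hab| |].
- intros d0; apply continuity_pt_filterlim, (continuous_intro (fun d => V d 1)); intros e He.
  destruct (iterate_continuous_data (/ INR n) d0 n e) as [eta [H1 H2]]; [lra|exact He|].
  exists eta; split; [exact H1|]; intros y Hy; apply H2; [exact Hy|lra].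
- now apply Hsgn; apply HV.
- exists (V d); split; [apply HV|split; [|exact H0]].
  now rewrite (proj2 (HV d)).
Qed.

(** The solutions with delay [1 / n] are equi-Lipschitz; a uniform cluster point keeps the closed
    conditions at 0 and 1, and the integral equation passes to the limit by [drop_close]. *)
Lemma delayed_limit (a b M : R) :
  (forall x, G x <= M) ->
  (forall n, (1 <= n)%nat ->
    exists v, delayed_solution N G lam (/ INR n) v /\ a <= v 0 <= b /\ v 1 = 0) ->
  exists v, delayed_solution N G lam 0 v /\ a <= v 0 <= b /\ v 1 = 0.
Proof.
intros HM Hex.
set (L := lam * root N M).
assert (HL : 0 <= L) by (apply Rmult_le_pos; [lra|apply root_nonneg]).
assert (Hex' : forall n, exists v,
  delayed_solution N G lam (/ INR (S n)) v /\ a <= v 0 <= b /\ v 1 = 0)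
  by (intros n; apply Hex; lia).
set (F := fun n => proj1_sig (constructive_indefinite_description _ (Hex' n))).
assert (HF : forall n, delayed_solution N G lam (/ INR (S n)) (F n) /\
  a <= F n 0 <= b /\ F n 1 = 0)
  by (intros n; exact (proj2_sig (constructive_indefinite_description _ (Hex' n)))).
clearbody F.
assert (Hdn : forall n, 0 <= / INR (S n))
  by (intros n; left; apply Rinv_0_lt_compat, lt_0_INR; lia).
assert (HLF : forall n x y, 0 <= x <= 1 -> 0 <= y <= 1 ->
  Rabs (F n x - F n y) <= L * Rabs (x - y)).
{ intros n; apply (solution_lipschitz (/ INR (S n))); auto; apply HF. }
destruct (cluster_function F b L) as [v0 Hv0]; [|exact HLF|].
{ intros n x Hx; destruct (HF n) as [Hs [Hn0 Hn1]].
  assert (F n 1 <= F n x) by (apply (solution_decreasing (/ INR (S n))); auto; lra).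
  assert (F n x <= F n 0) by (apply (solution_decreasing (/ INR (S n))); auto; lra).
  rewrite Rabs_right; lra. }
(* The cluster function is controlled on [[0, 1]] only; clamping makes it continuous on the line. *)
set (v := fun x => v0 (clamp 1 x)).
assert (Hv : forall e n0, 0 < e -> exists n, (n0 <= n)%nat /\
  forall x, 0 <= x <= 1 -> Rabs (F n x - v x) <= e).
{ intros e n0 He; destruct (Hv0 e n0 He) as [n [Hn H]]; exists n; split; [exact Hn|].
  intros x Hx; unfold v; rewrite clamp_id; auto. }
assert (HvL : forall x y, 0 <= x <= 1 -> 0 <= y <= 1 -> Rabs (v x - v y) <= L * Rabs (x - y)).
{ intros x y Hx Hy; apply le_epsilon; intros e He.
  destruct (Hv (e / 2) 0%nat) as [n [_ Hn]]; [lra|].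
  assert (H1 := Hn x Hx); assert (H2 := Hn y Hy); assert (H3 := HLF n x y Hx Hy).
  revert H3; generalize (L * Rabs (x - y)); intros z H3.
  revert H1 H2 H3; unfold Rabs; repeat destruct Rcase_abs; lra. }
assert (Hvc : forall x, continuous v x).
{ intros x; apply (continuous_lip _ L); intros y.
  assert (Hcl : forall z, v z = v (clamp 1 z)).
  { intros z; unfold v; rewrite (clamp_id 1 (clamp 1 z)); auto; apply clamp_range; lra. }
  rewrite (Hcl x), (Hcl y).
  eapply Rle_trans; [apply HvL; apply clamp_range; lra|].
  apply Rmult_le_compat_l; [exact HL|apply clamp_dist]. }
assert (H1 : v 1 = 0).
{ apply eq_of_small; intros e He; destruct (Hv e 0%nat He) as [n [_ Hn]].
  rewrite Rminus_0_r, <- Rabs_Ropp; replace (- v 1) with (F n 1 - v 1); [apply Hn; lra|].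
  destruct (HF n) as [_ [_ ->]]; ring. }
assert (H0 : a <= v 0 <= b).
{ split; apply le_epsilon; intros e He; destruct (Hv e 0%nat He) as [n [_ Hn]];
    specialize (Hn 0 ltac:(lra)); apply Rabs_le_between in Hn;
    destruct (HF n) as [_ [Hab _]]; lra. }
exists v; split; [split; [exact Hvc|]|now split].
intros r Hr; apply eq_of_small; intros e He.
(* One [e'] is spent at [r], one at 0, and [lam * e'] on the operator. *)
set (e' := e / (2 + lam)).
assert (He' : 0 < e') by (unfold e'; apply Rdiv_lt_0_compat; lra).
destruct (G_unif (e' ^ N)) as [eta [Heta HG]]; [now apply pow_lt|].
(* For such indices, removing the delay moves [v] by at most [eta / 4]; with the uniform error
   [eta / 4] the total stays below [eta]. *)
destruct (archimed_cor1 (eta / 4 / (L + 1))) as [n0 [Hn0 Hn0']];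
  [apply Rdiv_lt_0_compat; lra|].
destruct (Hv (Rmin e' (eta / 4)) n0) as [n [Hn Hclose]]; [apply Rmin_pos; lra|].
destruct (HF n) as [[HFc HFeq] _].
assert (Hdelta : L * / INR (S n) <= eta / 4).
{ assert (Hle : / INR (S n) <= / INR n0)
    by (apply Rinv_le_contravar; [apply lt_0_INR; lia|apply le_INR; lia]).
  apply Rle_trans with ((L + 1) * (eta / 4 / (L + 1))); [|right; field; lra].
  apply Rmult_le_compat; auto; lra. }
assert (Hd : Rabs (drop N G (delay (/ INR (S n)) (F n)) r - drop N G (delay 0 v) r) <= e').
{ apply (drop_close N G HN G_cont eta); auto; try lra.
  - intros; now apply continuous_delay.
  - intros; now apply continuous_delay.
  - intros t Ht; unfold delay.
    assert (Hr1 : 0 <= Rmax (t - / INR (S n)) 0 <= t) by now apply Rmax_shift_range.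
    assert (Hr2 : 0 <= Rmax (t - 0) 0 <= t) by (apply Rmax_shift_range; lra).
    assert (E1 := Hclose (Rmax (t - / INR (S n)) 0) ltac:(lra)).
    assert (E2 := HvL (Rmax (t - / INR (S n)) 0) (Rmax (t - 0) 0) ltac:(lra) ltac:(lra)).
    assert (E3 : L * Rabs (Rmax (t - / INR (S n)) 0 - Rmax (t - 0) 0) <= L * / INR (S n)).
    { apply Rmult_le_compat_l; [exact HL|]. specialize (Hdn n).
      unfold Rmax; repeat destruct Rle_dec; unfold Rabs; repeat destruct Rcase_abs; lra. }
    assert (E4 := Rmin_r e' (eta / 4)).
    replace (F n (Rmax (t - / INR (S n)) 0) - v (Rmax (t - 0) 0)) with
      ((F n (Rmax (t - / INR (S n)) 0) - v (Rmax (t - / INR (S n)) 0)) +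
       (v (Rmax (t - / INR (S n)) 0) - v (Rmax (t - 0) 0))) by ring.
    eapply Rle_lt_trans; [apply Rabs_triang|lra]. }
assert (E1 := Hclose r Hr); assert (E2 := Hclose 0 ltac:(lra)).
assert (E3 := Rmin_l e' (eta / 4)).
rewrite (HFeq r Hr) in E1.
apply Rabs_le_between in E1; apply Rabs_le_between in E2; apply Rabs_le_between in Hd.
assert (He2 : e = 2 * e' + lam * e') by (unfold e'; field; lra).
destruct Hd as [Hd1 Hd2].
apply Rmult_le_compat_l with (r := lam) in Hd1; [|lra].
apply Rmult_le_compat_l with (r := lam) in Hd2; [|lra].
apply Rabs_le; lra.
Qed.

End Delayed.

(** * Regularity of solutions of the integral equation *)

Definition integral_solution (N : nat) (G : R -> R) (lam : R) (v : R -> R) : Prop :=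
  (forall x, continuous v x) /\
  (forall r, 0 <= r <= 1 -> v r = v 0 - lam * drop N G v r) /\ v 1 = 0 /\ 0 < v 0.

(** The equation is written for [- u1], which is positive on [(0, 1)], so that it has the same form
    for even and odd [N]; signs enter only in the translation to (MO). *)
Definition concave_solution (N : nat) (g : R -> R) (lam : R) (u : R -> R) : Prop :=
  exists u1 u2 : R -> R,
    (forall x, is_derive u x (u1 x)) /\
    (forall x, is_derive u1 x (u2 x)) /\
    (forall x, continuous u2 x) /\
    (forall r, 0 < r < 1 ->
       is_derive (fun s => (- u1 s) ^ N) r (lam ^ N * INR N * r ^ (N - 1) * g (u r))) /\
    u1 0 = 0 /\ u 1 = 0 /\
    (forall r, 0 < r < 1 -> 0 < u r) /\
    (forall r, 0 < r < 1 -> u2 r < 0).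

(** Derivatives are compared in the open interval only, because [slope] is differentiated below only
    at positive points. *)
Lemma eq_of_derive_eq (f h df : R -> R) (a b : R) :
  a <= b ->
  (forall x, a < x < b -> is_derive f x (df x)) ->
  (forall x, a < x < b -> is_derive h x (df x)) ->
  (forall x, a <= x <= b -> continuous f x) ->
  (forall x, a <= x <= b -> continuous h x) ->
  f b - f a = h b - h a.
Proof.
intros Hab Hf Hh Cf Ch.
destruct (MVT_gen (fun x => f x - h x) a b (fun _ => 0)) as [c [_ Hc]]; [| |lra].
- rewrite Rmin_left, Rmax_right by lra; intros x Hx.
  replace 0 with (df x - df x) by ring.
  apply (is_derive_minus (V := R_NormedModule)); auto.
- rewrite Rmin_left, Rmax_right by lra; intros x Hx; apply continuity_pt_filterlim.
  apply (continuous_minus (V := R_NormedModule)); auto.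
Qed.

Section Regularity.

Variables (N : nat) (G : R -> R).
Hypothesis HN : (1 <= N)%nat.
Hypothesis G_cont : forall x, continuous G x.
Hypothesis G_nonneg : forall x, 0 <= G x.

Variables (lam : R) (v : R -> R).
Hypothesis lam_pos : 0 < lam.
Hypothesis v_sol : integral_solution N G lam v.
Hypothesis G_pos : forall s, 0 < s <= v 0 -> 0 < G s.

Lemma G_near_start (e : R) : 0 < e ->
  exists d, 0 < d /\ forall t, Rabs t < d -> Rabs (G (v t) - G (v 0)) < e.
Proof.
intros He; destruct v_sol as [Hc _].
destruct (continuous_elim (fun t => G (v t)) 0 e) as [d [Hd H]]; [|exact He|].
- apply continuous_comp; auto.
- exists d; split; [exact Hd|]; intros t Ht; apply H; now rewrite Rminus_0_r.
Qed.

(** Near 0 the integrand is at least half of [G (v 0)] times the weight, and [mass] never decreases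
    afterwards. *)
Lemma mass_pos (r : R) : 0 < r -> 0 < mass N G v r.
Proof.
intros Hr; destruct v_sol as [Hc [_ [_ Hv0]]].
assert (HG0 : 0 < G (v 0)) by (apply G_pos; lra).
destruct (G_near_start (G (v 0) / 2)) as [d [Hd H]]; [lra|].
assert (Hm : 0 < Rmin r d) by now apply Rmin_pos.
apply Rlt_le_trans with (G (v 0) / 2 * Rmin r d ^ N).
- apply Rmult_lt_0_compat; [lra|now apply pow_lt].
- apply Rle_trans with (mass N G v (Rmin r d)).
  + apply mass_lower; auto; [lra|]; intros t Ht.
    assert (Ht' := Rmin_r r d).
    assert (Hg := H t ltac:(rewrite Rabs_right; lra)).
    apply Rabs_lt_between in Hg; lra.
  + apply mass_mono; auto; split; [lra|apply Rmin_l].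
Qed.

(** The slope at [r] is positive and persists, so [v] falls strictly from [r] to 1, where it
    vanishes. *)
Lemma integral_solution_pos (r : R) : 0 <= r < 1 -> 0 < v r.
Proof.
intros Hr; destruct v_sol as [Hc [Heq [H1 Hv0]]].
destruct (Req_dec r 0) as [->|Hr0]; [assumption|].
destruct (drop_increment N G HN G_cont G_nonneg v r 1 Hc) as [H _]; [lra|].
assert (Hs : 0 < slope N G v r) by (apply root_pos, mass_pos; lra).
assert (Hp : 0 < (1 - r) * slope N G v r) by (apply Rmult_lt_0_compat; lra).
assert (E1 := Heq r ltac:(lra)); assert (E2 := Heq 1 ltac:(lra)).
assert (0 < lam * (drop N G v 1 - drop N G v r)) by (apply Rmult_lt_0_compat; lra).
lra.
Qed.

Lemma integral_solution_le (r : R) : 0 <= r <= 1 -> v r <= v 0.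
Proof.
intros Hr; destruct v_sol as [Hc [Heq _]].
destruct (drop_increment N G HN G_cont G_nonneg v 0 r Hc) as [H _]; [lra|].
rewrite slope_0, drop_0 in H.
assert (E1 := Heq r Hr).
assert (0 <= lam * drop N G v r) by (apply Rmult_le_pos; lra).
lra.
Qed.

(** The weighted average of [G (v t)] over [[0, r]], continued by its limit at 0. Writing [slope] as
    [r] times its root isolates the degeneracy at the origin. *)
Definition mean_mass (r : R) : R :=
  if Rle_dec r 0 then G (v 0) else mass N G v r / r ^ N.

Lemma mean_mass_continuous (x : R) : continuous mean_mass x.
Proof.
destruct v_sol as [Hc _].
destruct (Rtotal_order x 0) as [Hx|[->|Hx]].
- apply continuous_ext_loc with (fun _ => G (v 0)); [|apply continuous_const].
  exists (mkposreal (- x) ltac:(lra)); intros y Hy.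
  apply Rabs_lt_between in Hy; simpl in Hy; unfold minus, plus, opp in Hy; simpl in Hy.
  unfold mean_mass; destruct Rle_dec; [reflexivity|lra].
- apply continuous_intro; intros e He.
  destruct (G_near_start (e / 2)) as [d [Hd H]]; [lra|].
  exists d; split; [exact Hd|]; intros y Hy; rewrite Rminus_0_r in Hy.
  unfold mean_mass at 2; destruct Rle_dec; [|lra].
  unfold mean_mass; destruct Rle_dec as [|Hy0]; [rewrite Rminus_diag, Rabs_R0; lra|].
  apply Rnot_le_lt in Hy0; rewrite Rabs_right in Hy by lra.
  assert (Hp : 0 < y ^ N) by now apply pow_lt.
  assert (Hb : forall t, 0 < t < y -> G (v 0) - e / 2 <= G (v t) <= G (v 0) + e / 2).
  { intros t Ht; assert (Hg := H t ltac:(rewrite Rabs_right; lra)).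
    apply Rabs_lt_between in Hg; lra. }
  assert (B1 : (G (v 0) - e / 2) * y ^ N <= mass N G v y)
    by (apply mass_lower; auto; [lra|]; intros t Ht; apply Hb, Ht).
  assert (B2 : mass N G v y <= (G (v 0) + e / 2) * y ^ N)
    by (apply mass_upper; auto; [lra|]; intros t Ht; apply Hb, Ht).
  apply Rle_lt_trans with (e / 2); [|lra]; apply Rabs_le; split.
  + apply Rmult_le_reg_r with (y ^ N); [exact Hp|].
    replace ((mass N G v y / y ^ N - G (v 0)) * y ^ N) with (mass N G v y - G (v 0) * y ^ N)
      by (field; lra); lra.
  + apply Rmult_le_reg_r with (y ^ N); [exact Hp|].
    replace ((mass N G v y / y ^ N - G (v 0)) * y ^ N) with (mass N G v y - G (v 0) * y ^ N)
      by (field; lra); lra.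
- apply continuous_ext_loc with (fun r => mass N G v r / r ^ N).
  + exists (mkposreal x Hx); intros y Hy.
    apply Rabs_lt_between in Hy; simpl in Hy; unfold minus, plus, opp in Hy; simpl in Hy.
    unfold mean_mass; destruct Rle_dec; [lra|reflexivity].
  + apply (continuous_mult (K := R_AbsRing)).
    * eapply is_derive_continuous, mass_derive; auto.
    * apply (continuous_comp (fun r => r ^ N) Rinv).
      { eapply is_derive_continuous, is_derive_weight. }
      apply continuous_Rinv; apply pow_nonzero; lra.
Qed.

Lemma mean_mass_pos (r : R) : 0 < mean_mass r.
Proof.
unfold mean_mass; destruct Rle_dec as [|H].
- apply G_pos; destruct v_sol as [_ [_ [_ H]]]; lra.
- apply Rdiv_lt_0_compat; [apply mass_pos; lra|apply pow_lt; lra].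
Qed.

Lemma slope_mean_mass (r : R) : 0 < r -> slope N G v r = r * root N (mean_mass r).
Proof.
intros Hr; rewrite <- root_mult_pow; [|assumption|lra|left; apply mean_mass_pos].
unfold slope, mean_mass; destruct Rle_dec; [lra|].
f_equal; field; apply pow_nonzero; lra.
Qed.

(** Differentiating [slope ^ N = mass] gives [slope' = r ^ (N - 1) * G (v r) / slope ^ (N - 1)]. The
    powers of [r] cancel, leaving an expression that is continuous at 0 as well. *)
Definition curvature (r : R) : R := G (v r) / root N (mean_mass r) ^ (N - 1).

Lemma slope_derive (r : R) : 0 < r -> is_derive (slope N G v) r (curvature r).
Proof.
intros Hr; destruct v_sol as [Hc _].
assert (Hm := mass_pos r Hr).
assert (Hs : 0 < slope N G v r) by now apply root_pos.
assert (HN0 : 0 < INR N) by (apply lt_0_INR; lia).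
assert (Heq : slope N G v r = Rpower (mass N G v r) (/ INR N))
  by (unfold slope, root; destruct Rle_dec; lra).
apply is_derive_ext_loc with (fun s => Rpower (mass N G v s) (/ INR N)).
{ exists (mkposreal r Hr); intros y Hy.
  apply Rabs_lt_between in Hy; simpl in Hy; unfold minus, plus, opp in Hy; simpl in Hy.
  unfold slope, root; destruct Rle_dec as [H|]; [|reflexivity].
  assert (0 < mass N G v y) by (apply mass_pos; lra); lra. }
replace (curvature r) with
  (scal (INR N * r ^ (N - 1) * G (v r)) (/ INR N * Rpower (mass N G v r) (/ INR N - 1))).
- apply (is_derive_comp (V := R_NormedModule) (fun y => Rpower y (/ INR N)) (mass N G v)).
  + apply is_derive_Reals, derivable_pt_lim_power, Hm.
  + now apply mass_derive.
- unfold scal; simpl; unfold mult; simpl; unfold curvature.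
  assert (HR : root N (mean_mass r) = slope N G v r / r)
    by (rewrite slope_mean_mass by exact Hr; field; lra).
  rewrite HR; unfold Rdiv at 2; rewrite Rpow_mult_distr, pow_inv.
  unfold Rminus; rewrite Rpower_plus, Rpower_Ropp, Rpower_1, <- Heq by exact Hm.
  assert (Hpow : mass N G v r = slope N G v r * slope N G v r ^ (N - 1)).
  { rewrite tech_pow_Rmult; replace (S (N - 1)) with N by lia.
    unfold slope; rewrite root_pow; auto; lra. }
  rewrite Hpow; field; repeat split; try lra; try (apply pow_nonzero; lra).
Qed.

Lemma curvature_continuous (x : R) : continuous curvature x.
Proof.
destruct v_sol as [Hc _].
apply (continuous_mult (K := R_AbsRing)); [apply continuous_comp; auto|].
apply (continuous_comp (fun r => root N (mean_mass r) ^ (N - 1)) Rinv).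
- apply (continuous_comp (fun r => root N (mean_mass r)) (fun y => y ^ (N - 1))).
  + apply continuous_comp; [apply mean_mass_continuous|now apply continuous_root].
  + eapply is_derive_continuous, is_derive_weight.
- apply continuous_Rinv, pow_nonzero; apply Rgt_not_eq, root_pos, mean_mass_pos.
Qed.

Lemma curvature_pos (r : R) : 0 <= r < 1 -> 0 < curvature r.
Proof.
intros Hr; apply Rdiv_lt_0_compat.
- apply G_pos; split; [now apply integral_solution_pos|apply integral_solution_le; lra].
- apply pow_lt, root_pos, mean_mass_pos.
Qed.

(* Freezing the curvature outside [0,1] and integrating it twice gives the C^2
   extension of v to the whole line. *)
Lemma integral_solution_regular :
  exists u, concave_solution N G lam u /\ forall r, 0 <= r <= 1 -> u r = v r.
Proof.
destruct v_sol as [Hc [Heq [H1 Hv0]]].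
set (u2 := fun x => - lam * curvature (clamp 1 x)).
(* The base points 0 here and 1 for [u] build in the boundary conditions [u'(0) = 0] and
   [u(1) = 0]. *)
set (u1 := RInt u2 0).
set (u := RInt u1 1).
assert (C2 : forall x, continuous u2 x).
{ intros x; apply (continuous_scal_r (K := R_AbsRing) (V := R_NormedModule)).
  apply (continuous_comp (clamp 1) curvature); [apply continuous_clamp|apply curvature_continuous]. }
assert (D1 : forall x, is_derive u1 x (u2 x)) by (intros; now apply is_derive_RInt_cont).
assert (C1 : forall x, continuous u1 x) by (intros x; eapply is_derive_continuous, D1).
assert (D0 : forall x, is_derive u x (u1 x)) by (intros; now apply is_derive_RInt_cont).
assert (C0 : forall x, continuous u x) by (intros x; eapply is_derive_continuous, D0).
assert (u1_0 : u1 0 = 0) by apply (RInt_point (V := R_CompleteNormedModule)).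
assert (u_1 : u 1 = 0) by apply (RInt_point (V := R_CompleteNormedModule)).
assert (E1 : forall r, 0 <= r <= 1 -> u1 r = - lam * slope N G v r).
{ intros r Hr.
  assert (H : u1 r - u1 0 = - lam * slope N G v r - - lam * slope N G v 0).
  { apply (eq_of_derive_eq u1 (fun s => - lam * slope N G v s) u2); try (intros; auto; lra).
    - intros x Hx; unfold u2; rewrite clamp_id by lra.
      apply (is_derive_scal (slope N G v)), slope_derive; lra.
    - intros x Hx; apply (continuous_scal_r (K := R_AbsRing) (V := R_NormedModule)).
      now apply slope_continuous. }
  rewrite u1_0, slope_0 in H; lra. }
assert (E0 : forall r, 0 <= r <= 1 -> u r = v r).
{ intros r Hr.
  assert (Dz : forall x, is_derive (fun s => - lam * drop N G v s) x (- lam * slope N G v x)).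
  { intros x; apply (is_derive_scal (drop N G v)); now apply drop_derive. }
  assert (H : u 1 - u r = - lam * drop N G v 1 - - lam * drop N G v r).
  { apply (eq_of_derive_eq u (fun s => - lam * drop N G v s) u1); try (intros; auto; lra).
    - intros x Hx; rewrite E1 by lra; apply Dz.
    - intros x Hx; eapply is_derive_continuous, Dz. }
  rewrite u_1 in H; assert (A1 := Heq 1 ltac:(lra)); assert (A2 := Heq r Hr); lra. }
exists u; split; [|exact E0].
exists u1, u2; repeat (split; [assumption|]); split; [|split; [exact u1_0|split; [exact u_1|split]]].
- intros r Hr; rewrite E0 by lra.
  apply is_derive_ext_loc with (fun s => lam ^ N * mass N G v s).
  + assert (Hm : 0 < Rmin r (1 - r)) by (apply Rmin_pos; lra).
    exists (mkposreal _ Hm); intros y Hy.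
    apply Rabs_lt_between in Hy; simpl in Hy; unfold minus, plus, opp in Hy; simpl in Hy.
    assert (M1 := Rmin_l r (1 - r)); assert (M2 := Rmin_r r (1 - r)).
    rewrite E1 by lra.
    replace (- (- lam * slope N G v y)) with (lam * slope N G v y) by ring.
    rewrite Rpow_mult_distr; unfold slope; rewrite root_pow; auto.
    left; apply mass_pos; lra.
  + replace (lam ^ N * INR N * r ^ (N - 1) * G (v r)) with
      (lam ^ N * (INR N * r ^ (N - 1) * G (v r))) by ring.
    apply (is_derive_scal (mass N G v)); now apply mass_derive.
- intros r Hr; rewrite E0 by lra; apply integral_solution_pos; lra.
- intros r Hr; unfold u2; rewrite clamp_id by lra.
  assert (Hk : 0 < curvature r) by (apply curvature_pos; lra).
  assert (0 < lam * curvature r) by (now apply Rmult_lt_0_compat); lra.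
Qed.

End Regularity.

(** The mean value theorem on both sides of the intermediate point writes the concavity defect as
    [t * (1 - t) * (y - x)] times a difference of values of the strictly decreasing [u1]. *)
Lemma strictly_concave_of_derive (u u1 u2 : R -> R) :
  (forall x, is_derive u x (u1 x)) -> (forall x, is_derive u1 x (u2 x)) ->
  (forall r, 0 < r < 1 -> u2 r < 0) -> strictly_concave_on_01 u.
Proof.
intros D0 D1 Hneg.
assert (Hdec : forall a b, 0 < a -> a < b -> b < 1 -> u1 b < u1 a).
{ intros a b Ha Hab Hb.
  destruct (MVT_cor2 u1 u2 a b Hab) as [c [Hc Hc']]; [intros; now apply is_derive_Reals|].
  assert (u2 c < 0) by (apply Hneg; lra).
  nra. }
assert (main : forall x y t, 0 < x -> x < y -> y < 1 -> 0 < t < 1 ->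
  u (t * x + (1 - t) * y) > t * u x + (1 - t) * u y).
{ intros x y t Hx Hxy Hy Ht; set (z := t * x + (1 - t) * y).
  assert (Hz1 : z - x = (1 - t) * (y - x)) by (unfold z; ring).
  assert (Hz2 : y - z = t * (y - x)) by (unfold z; ring).
  assert (0 < (1 - t) * (y - x)) by (apply Rmult_lt_0_compat; lra).
  assert (0 < t * (y - x)) by (apply Rmult_lt_0_compat; lra).
  destruct (MVT_cor2 u u1 x z) as [c1 [Hc1 Hc1']]; [lra|intros; now apply is_derive_Reals|].
  destruct (MVT_cor2 u u1 z y) as [c2 [Hc2 Hc2']]; [lra|intros; now apply is_derive_Reals|].
  assert (Hd : u1 c2 < u1 c1) by (apply Hdec; lra).
  rewrite Hz1 in Hc1; rewrite Hz2 in Hc2.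
  assert (Hp : 0 < t * ((1 - t) * (y - x)) * (u1 c1 - u1 c2))
    by (repeat apply Rmult_lt_0_compat; lra).
  assert (t * (u z - u x) + (1 - t) * (u z - u y) =
    t * ((1 - t) * (y - x)) * (u1 c1 - u1 c2)); [|lra].
  replace (u z - u y) with (- (u y - u z)) by ring; rewrite Hc1, Hc2; ring. }
intros x y t Hx Hy Hne Ht; destruct (Rtotal_order x y) as [H|[H|H]]; [|lra|].
- apply main; lra.
- assert (Hm := main y x (1 - t) ltac:(lra) H ltac:(lra) ltac:(lra)).
  replace (1 - (1 - t)) with t in Hm by ring.
  rewrite (Rplus_comm (t * x)), (Rplus_comm (t * u x)); exact Hm.
Qed.

Lemma concave_solution_ext (N : nat) (G g : R -> R) (lam : R) (u : R -> R) :
  (forall r, 0 < r < 1 -> G (u r) = g (u r)) ->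
  concave_solution N G lam u -> concave_solution N g lam u.
Proof.
intros H [u1 [u2 [D0 [D1 [C2 [E [H0 [H1 [Hp Hn]]]]]]]]].
exists u1, u2; repeat (split; [assumption|]); split; [|now repeat split].
intros r Hr; rewrite <- H by exact Hr; now apply E.
Qed.

(** * Existence of two solutions *)

(** Heine's theorem on [[0, D]], transported to the line by the 1-Lipschitz map [clamp]. *)
Lemma truncation_unif (g : R -> R) (D e : R) :
  (forall x, continuous g x) -> 0 <= D -> 0 < e ->
  exists eta, 0 < eta /\ forall x y, Rabs (x - y) < eta ->
    Rabs (g (clamp D x) - g (clamp D y)) <= e.
Proof.
intros Hg HD He.
destruct (@Heine_cor2 g 0 D (fun x _ => proj2 (continuity_pt_filterlim g x) (Hg x))
  (mkposreal e He)) as [eta Heta].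
exists eta; split; [apply cond_pos|].
intros x y Hxy; left; apply Heta; try (now apply clamp_range).
eapply Rle_lt_trans; [apply clamp_dist|exact Hxy].
Qed.

Lemma delayed_0_integral (N : nat) (G : R -> R) (lam : R) (v : R -> R) :
  delayed_solution N G lam 0 v -> v 1 = 0 -> 0 < v 0 -> integral_solution N G lam v.
Proof.
intros [Hc Heq] H1 H0; split; [exact Hc|split; [|now split]].
intros r Hr; rewrite (Heq r Hr); do 2 f_equal.
apply (drop_local N G _ _ r); [|lra].
intros t Ht; unfold delay; rewrite Rmax_left; [f_equal; ring|lra].
Qed.

(** Both halves of the result reduce to this statement. The solutions are found with starting values
    in [[d0, 1]] and [[1, D]], and the strict order at 0 tells them apart. *)
Theorem two_concave_solutions (N : nat) (g : R -> R) :
  (1 <= N)%nat ->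
  (forall x, continuous g x) ->
  g 0 = 0 ->
  (forall s, 0 < s -> 0 < g s) ->
  (forall e, 0 < e -> exists d, 0 < d /\ forall s, 0 < s < d -> g s <= e * s ^ N) ->
  (forall e, 0 < e -> exists M, 0 < M /\ forall s, M < s -> g s <= e * s ^ N) ->
  exists lam0, 0 < lam0 /\ forall lam, lam0 < lam -> exists u1 u2,
    concave_solution N g lam u1 /\ concave_solution N g lam u2 /\ u1 0 < u2 0.
Proof.
intros HN Hg g0 Hpos Hzero Hinf.
assert (Hg' : forall x, continuity_pt g x) by (intros x; apply continuity_pt_filterlim, Hg).
destruct (continuity_ab_min g (/ 2) 1) as [sm [Hsm Hsm']]; [lra|auto|].
set (m := g sm) in *.
assert (Hm : 0 < m) by (apply Hpos; lra).
assert (Hrm : 0 < root N m) by now apply root_pos.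
(* The threshold beyond which solutions started at 1 end below 0; [m] is the minimum of [g] on
   [[1/2, 1]]. *)
exists (4 / root N m); split; [apply Rdiv_lt_0_compat; lra|].
intros lam Hlam.
assert (lam_pos : 0 < lam) by (assert (0 < 4 / root N m) by (apply Rdiv_lt_0_compat; lra); lra).
assert (Hlam' : 4 < lam * root N m).
{ apply Rmult_lt_compat_r with (r := root N m) in Hlam; [|exact Hrm].
  replace (4 / root N m * root N m) with 4 in Hlam by (field; lra); exact Hlam. }
assert (HlN : 0 < lam ^ N) by now apply pow_lt.
(* With this [eps], [g s <= eps * s ^ N] bounds the [N]-th power of the fall from [d] by half of
   [d ^ N]. *)
set (eps := / (2 * lam ^ N)).
assert (Heps : 0 < eps) by (apply Rinv_0_lt_compat; lra).
assert (Heps' : lam ^ N * eps = / 2) by (unfold eps; field; lra).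
destruct (Hzero eps Heps) as [delta [Hdelta Hsmall]].
destruct (Hinf eps Heps) as [M [HM Hlarge]].
set (d0 := Rmin (delta / 2) (/ 2)).
assert (Hd0 : 0 < d0) by (apply Rmin_pos; lra).
assert (Hd01 : d0 <= / 2) by apply Rmin_r.
assert (Hd02 : d0 < delta) by (assert (d0 <= delta / 2) by apply Rmin_l; lra).
destruct (continuity_ab_maj g 0 M) as [sM [HsM _]]; [lra|auto|].
set (K := g sM) in *.
assert (HK : 0 <= K) by (rewrite <- g0; apply HsM; lra).
(* Beyond the range where [g] is small relative to [s ^ N], and large enough that
   [lam ^ N * K < D <= D ^ N] also handles the values of [g] on [[0, M]]. *)
set (D := 2 + M + lam ^ N * K).
assert (HlK : 0 <= lam ^ N * K) by (apply Rmult_le_pos; lra).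
assert (HD : 2 <= D) by (unfold D; lra).
assert (HDN : D <= D ^ N).
{ rewrite <- (pow_1 D) at 1; apply Rle_pow; [lra|exact HN]. }
(* The truncation is bounded and uniformly continuous on the line, and agrees with [g] on [[0, D]],
   where the final solutions take their values on [[0, 1]]. *)
set (G := fun s => g (clamp D s)).
assert (G_cont : forall x, continuous G x)
  by (intros x; apply (continuous_comp (clamp D) g); [apply continuous_clamp|apply Hg]).
assert (g_nonneg : forall s, 0 <= s -> 0 <= g s)
  by (intros s [Hs|<-]; [left; now apply Hpos|lra]).
assert (G_nonneg : forall x, 0 <= G x) by (intros x; apply g_nonneg, clamp_range; lra).
assert (G_unif : forall e, 0 < e -> exists eta, 0 < eta /\
  forall x y, Rabs (x - y) < eta -> Rabs (G x - G y) <= e)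
  by (intros; apply truncation_unif; auto; lra).
assert (HGmax : exists B, forall x, G x <= B).
{ destruct (continuity_ab_maj g 0 D) as [sD [HsD _]]; [lra|auto|].
  exists (g sD); intros x; apply HsD, clamp_range; lra. }
destruct HGmax as [B HB].
assert (end_d0 : forall delta' v, 0 <= delta' -> delayed_solution N G lam delta' v ->
  v 0 = d0 -> 0 < v 1).
{ intros delta' v Hd' Hv Hv0.
  apply (solution_end_pos N G HN G_cont G_nonneg lam lam_pos delta' v Hd' Hv (eps * d0 ^ N)).
  - lra.
  - rewrite Hv0; intros s Hs; unfold G.
    assert (Hc := clamp_range D s ltac:(lra)).
    assert (Hc' : clamp D s <= d0) by (unfold clamp, Rmin, Rmax; repeat destruct Rle_dec; lra).
    destruct (Req_dec (clamp D s) 0) as [->|Hne].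
    + rewrite g0; apply Rmult_le_pos; [lra|apply pow_le; lra].
    + apply Rle_trans with (eps * clamp D s ^ N); [apply Hsmall; lra|].
      apply Rmult_le_compat_l; [lra|apply pow_incr; lra].
  - rewrite Hv0, <- Rmult_assoc, Heps'.
    assert (0 < d0 ^ N) by (now apply pow_lt); lra. }
assert (end_D : forall delta' v, 0 <= delta' -> delayed_solution N G lam delta' v ->
  v 0 = D -> 0 < v 1).
{ intros delta' v Hd' Hv Hv0.
  apply (solution_end_pos N G HN G_cont G_nonneg lam lam_pos delta' v Hd' Hv
    (Rmax K (eps * D ^ N))).
  - lra.
  - intros s _; unfold G.
    assert (Hc := clamp_range D s ltac:(lra)).
    destruct (Rle_or_lt (clamp D s) M) as [Hle|Hlt].
    + eapply Rle_trans; [|apply Rmax_l]; apply HsM; lra.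
    + eapply Rle_trans; [|apply Rmax_r].
      apply Rle_trans with (eps * clamp D s ^ N); [now apply Hlarge|].
      apply Rmult_le_compat_l; [lra|apply pow_incr; lra].
  - rewrite Hv0; unfold Rmax; destruct Rle_dec.
    + rewrite <- Rmult_assoc, Heps'; lra.
    + unfold D in *; lra. }
assert (end_1 : forall delta' v, 0 <= delta' -> delayed_solution N G lam delta' v ->
  v 0 = 1 -> v 1 < 0).
{ intros delta' v Hd' Hv Hv0.
  apply (solution_end_neg N G HN G_cont G_nonneg lam lam_pos delta' v Hd' Hv m); auto.
  intros s Hs; unfold G; rewrite clamp_id by lra; now apply Hsm. }
assert (Hinv : forall n, (1 <= n)%nat -> 0 <= / INR n)
  by (intros n Hn; left; apply Rinv_0_lt_compat, lt_0_INR; lia).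
assert (finish : forall v, delayed_solution N G lam 0 v -> d0 <= v 0 <= D -> v 1 = 0 ->
  exists u, concave_solution N g lam u /\ u 0 = v 0).
{ intros v Hv Hv0 Hv1.
  assert (Hi : integral_solution N G lam v) by (apply delayed_0_integral; auto; lra).
  assert (G_pos : forall s, 0 < s <= v 0 -> 0 < G s)
    by (intros s Hs; unfold G; rewrite clamp_id by lra; apply Hpos; lra).
  destruct (integral_solution_regular N G HN G_cont G_nonneg lam v lam_pos Hi G_pos)
    as [u [Hu Huv]].
  exists u; split; [|apply Huv; lra].
  apply (concave_solution_ext N G); [|exact Hu].
  intros r Hr; unfold G; rewrite clamp_id; [reflexivity|].
  rewrite Huv by lra; split.
  - left; apply (integral_solution_pos N G HN G_cont G_nonneg lam v lam_pos Hi G_pos); lra.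
  - assert (v r <= v 0); [|lra].
    apply (integral_solution_le N G HN G_cont G_nonneg lam v lam_pos Hi); lra. }
destruct (delayed_limit N G HN G_cont G_nonneg G_unif lam lam_pos d0 1 B HB)
  as [v1 [Hs1 [Hr1 He1]]].
{ intros n Hn; apply (delayed_shooting N G HN G_cont G_unif lam lam_pos); auto; [lra|].
  intros v w Hv Hv0 Hw Hw0.
  assert (0 < v 1) by (apply (end_d0 (/ INR n)); auto).
  assert (w 1 < 0) by (apply (end_1 (/ INR n)); auto).
  nra. }
destruct (delayed_limit N G HN G_cont G_nonneg G_unif lam lam_pos 1 D B HB)
  as [v2 [Hs2 [Hr2 He2]]].
{ intros n Hn; apply (delayed_shooting N G HN G_cont G_unif lam lam_pos); auto; [lra|].
  intros v w Hv Hv0 Hw Hw0.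
  assert (v 1 < 0) by (apply (end_1 (/ INR n)); auto).
  assert (0 < w 1) by (apply (end_D (/ INR n)); auto).
  nra. }
(* The limit only gives closed ranges for the starting values. The end estimate at delay 0 excludes
   1 and separates the two solutions. *)
assert (Hn1 : v1 0 <> 1) by (intros H; specialize (end_1 0 v1 (Rle_refl 0) Hs1 H); lra).
assert (Hn2 : v2 0 <> 1) by (intros H; specialize (end_1 0 v2 (Rle_refl 0) Hs2 H); lra).
destruct (finish v1 Hs1) as [u1 [Hu1 Hu1']]; [lra|exact He1|].
destruct (finish v2 Hs2) as [u2 [Hu2 Hu2']]; [lra|exact He2|].
exists u1, u2; repeat split; auto; lra.
Qed.

(** * Translation to problem (MO) and the two signs *)

(** Since [u1 ^ N] is [(-1) ^ N] times [(- u1) ^ N], the sign in the nonlinearity cancels against a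
    second factor [(-1) ^ N]. *)
Lemma concave_solution_positive (N : nat) (f : R -> R) (lam : R) (u : R -> R) :
  concave_solution N (fun s => (-1) ^ N * f (- s)) lam u ->
  solves_MO N f lam u /\ positive_on_01 u /\ strictly_concave_on_01 u.
Proof.
intros [u1 [u2 [D0 [D1 [C2 [E [H0 [H1 [Hp Hn]]]]]]]]]; repeat split.
- exists u1, u2; repeat split; auto.
  + intros x; now apply is_derive_Reals.
  + intros x; now apply is_derive_Reals.
  + intros x; apply continuity_pt_filterlim, C2.
  + intros r Hr; apply is_derive_Reals.
    assert (Hs : (-1) ^ N * (-1) ^ N = 1)
      by (rewrite <- Rpow_mult_distr; replace (-1 * -1) with 1 by ring; apply pow1).
    apply is_derive_ext with (fun s => (-1) ^ N * (- u1 s) ^ N).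
    { intros s; rewrite <- Rpow_mult_distr; f_equal; ring. }
    replace (lam ^ N * INR N * r ^ (N - 1) * f (- u r)) with
      ((-1) ^ N * (lam ^ N * INR N * r ^ (N - 1) * ((-1) ^ N * f (- u r)))).
    * apply (is_derive_scal (fun s => (- u1 s) ^ N)), E, Hr.
    * transitivity ((-1) ^ N * (-1) ^ N * (lam ^ N * INR N * r ^ (N - 1) * f (- u r))); [ring|].
      rewrite Hs; ring.
- exact Hp.
- eapply strictly_concave_of_derive; eauto.
Qed.

(** The function [- u] has derivative [- u1] and (MO) evaluates [f] at [u], so the equations
    coincide. *)
Lemma concave_solution_negative (N : nat) (f : R -> R) (lam : R) (u : R -> R) :
  concave_solution N f lam u ->
  solves_MO N f lam (fun x => - u x) /\ negative_on_01 (fun x => - u x) /\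
  strictly_convex_on_01 (fun x => - u x).
Proof.
intros [u1 [u2 [D0 [D1 [C2 [E [H0 [H1 [Hp Hn]]]]]]]]]; repeat split.
- exists (fun x => - u1 x), (fun x => - u2 x); repeat split.
  + intros x; apply is_derive_Reals, (is_derive_opp u), D0.
  + intros x; apply is_derive_Reals, (is_derive_opp u1), D1.
  + intros x; apply continuity_pt_filterlim, (continuous_opp u2), C2.
  + intros r Hr; rewrite Ropp_involutive; now apply is_derive_Reals, E.
  + rewrite H0; ring.
  + rewrite H1; ring.
- intros r Hr; specialize (Hp r Hr); lra.
- assert (Hc : strictly_concave_on_01 u) by (eapply strictly_concave_of_derive; eauto).
  intros x y t Hx Hy Hne Ht; specialize (Hc x y t Hx Hy Hne Ht); lra.
Qed.

Lemma abs_le_of_quotient (N : nat) (f : R -> R) (e s : R) :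
  s <> 0 -> Rabs (f s / s ^ N) < e -> Rabs (f s) <= e * Rabs s ^ N.
Proof.
intros Hs H.
assert (Hp : 0 < Rabs s ^ N) by now apply pow_lt, Rabs_pos_lt.
rewrite Rabs_div, <- RPow_abs in H by now apply pow_nonzero.
apply Rmult_lt_compat_r with (r := Rabs s ^ N) in H; [|exact Hp].
replace (Rabs (f s) / Rabs s ^ N * Rabs s ^ N) with (Rabs (f s)) in H by (field; lra); lra.
Qed.

(** At a single small [s] in [(0, 1]], [f s] is within [e / 2] of 0 by the limit of the quotient,
    and of [f 0] by continuity. *)
Lemma f_at_0 (N : nat) (f : R -> R) :
  (1 <= N)%nat -> continuity f -> f_zero_at_0 N f -> f 0 = 0.
Proof.
intros HN Hc H0; apply eq_of_small; intros e He; rewrite Rminus_0_r.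
destruct (H0 (e / 2)) as [d [Hd Hf]]; [lra|].
destruct (continuous_elim f 0 (e / 2)) as [d' [Hd' Hf']];
  [apply continuity_pt_filterlim, Hc|lra|].
set (s := Rmin 1 (Rmin d d') / 2).
assert (Hm : 0 < Rmin 1 (Rmin d d')) by (repeat apply Rmin_pos; lra).
assert (M1 := Rmin_l 1 (Rmin d d')); assert (M2 := Rmin_r 1 (Rmin d d')).
assert (M3 := Rmin_l d d'); assert (M4 := Rmin_r d d').
assert (Hs : 0 < s <= 1) by (unfold s; lra).
assert (A1 : Rabs (f s) <= e / 2 * Rabs s ^ N).
{ apply abs_le_of_quotient; [lra|]; apply Hf; [lra|]; rewrite Rabs_right; unfold s; lra. }
assert (A2 : Rabs (f s - f 0) < e / 2)
  by (apply Hf'; rewrite Rminus_0_r, Rabs_right; unfold s; lra).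
rewrite (Rabs_right s) in A1 by lra.
assert (A3 : s ^ N <= 1) by (rewrite <- (pow1 N); apply pow_incr; lra).
assert (A4 : e / 2 * s ^ N <= e / 2) by nra.
revert A1 A2; unfold Rabs; repeat destruct Rcase_abs; lra.
Qed.

(* For a = 1 and a = -1 this covers the nonlinearities driving -u (u negative)
   and u (u positive). *)
Lemma two_concave_solutions_sign (N : nat) (f : R -> R) (a : R) :
  a = 1 \/ a = -1 -> (1 <= N)%nat -> cond_f1 N f -> f_zero_at_0 N f -> f_zero_at_infty N f ->
  exists lam0, 0 < lam0 /\ forall lam, lam0 < lam -> exists u1 u2,
    concave_solution N (fun s => a ^ N * f (a * s)) lam u1 /\
    concave_solution N (fun s => a ^ N * f (a * s)) lam u2 /\ u1 0 < u2 0.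
Proof.
intros Ha HN [Hc Hf] H0 Hinf.
assert (Haa : a ^ N * a ^ N = 1).
{ rewrite <- Rpow_mult_distr; replace (a * a) with 1; [apply pow1|destruct Ha; subst; ring]. }
assert (Habs : forall s, 0 < s -> Rabs (a * s) = s).
{ intros s Hs; destruct Ha; subst; [rewrite Rabs_right|rewrite Rabs_left]; lra. }
assert (Hane : forall s, 0 < s -> a * s <> 0) by (intros s Hs; destruct Ha; subst; lra).
assert (Hle : forall s, a ^ N * f (a * s) <= Rabs (f (a * s))).
{ intros s; eapply Rle_trans; [apply Rle_abs|].
  rewrite Rabs_mult, <- RPow_abs.
  replace (Rabs a) with 1 by (destruct Ha; subst; [rewrite Rabs_right|rewrite Rabs_left]; lra).
  rewrite pow1; lra. }
apply two_concave_solutions; auto.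
- intros x; apply (continuous_scal_r (K := R_AbsRing) (V := R_NormedModule)).
  apply (continuous_comp (fun s => a * s) f).
  + apply (continuous_scal_r (K := R_AbsRing) (V := R_NormedModule)), continuous_id.
  + apply continuity_pt_filterlim, Hc.
- rewrite Rmult_0_r, (f_at_0 N f); auto; ring.
- intros s Hs; specialize (Hf (a * s) (Hane s Hs)).
  (* The sign condition at [a * s] now contains the factor [a ^ N], and dividing by [s ^ N] leaves
     the claim. *)
  rewrite Rpow_mult_distr in Hf.
  assert (Hp : 0 < s ^ N) by now apply pow_lt.
  apply Rmult_lt_reg_r with (s ^ N); [exact Hp|]; lra.
- intros e He; destruct (H0 e He) as [d [Hd Hd']]; exists d; split; [exact Hd|].
  intros s Hs; eapply Rle_trans; [apply Hle|].
  rewrite <- (Habs s) at 2 by lra; apply abs_le_of_quotient; [apply Hane; lra|].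
  apply Hd'; [apply Hane; lra|rewrite Habs; lra].
- intros e He; destruct (Hinf e He) as [M [HM HM']]; exists M; split; [exact HM|].
  intros s Hs; eapply Rle_trans; [apply Hle|].
  rewrite <- (Habs s) at 2 by lra; apply abs_le_of_quotient; [apply Hane; lra|].
  apply HM'; rewrite Habs; lra.
Qed.

Theorem theorem4p5 (N : nat) (f : R -> R) :
  (1 <= N)%nat ->
  cond_f1 N f ->
  f_zero_at_0 N f ->
  f_zero_at_infty N f ->
  (exists lam_p : R, lam_p > 0 /\
     forall lam : R, lam > lam_p ->
       exists u1 u2 : R -> R,
         solves_MO N f lam u1 /\ solves_MO N f lam u2 /\
         distinct_on_01 u1 u2 /\
         positive_on_01 u1 /\ positive_on_01 u2 /\
         strictly_concave_on_01 u1 /\ strictly_concave_on_01 u2) /\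
  (exists lam_m : R, lam_m > 0 /\
     forall lam : R, lam > lam_m ->
       exists u1 u2 : R -> R,
         solves_MO N f lam u1 /\ solves_MO N f lam u2 /\
         distinct_on_01 u1 u2 /\
         negative_on_01 u1 /\ negative_on_01 u2 /\
         strictly_convex_on_01 u1 /\ strictly_convex_on_01 u2).
Proof.
intros HN Hf H0 Hinf; split.
(* Positive solutions see [f] on the negative axis, hence the sign [-1]. *)
- destruct (two_concave_solutions_sign N f (-1)) as [lam0 [Hlam0 H]]; auto.
  exists lam0; split; [exact Hlam0|]; intros lam Hlam.
  destruct (H lam Hlam) as [u1 [u2 [S1 [S2 Hlt]]]].
  assert (Hext : forall s, (-1) ^ N * f (-1 * s) = (-1) ^ N * f (- s))
    by (intros s; do 2 f_equal; ring).
  apply concave_solution_ext with (g := fun s => (-1) ^ N * f (- s)) in S1; [|auto].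
  apply concave_solution_ext with (g := fun s => (-1) ^ N * f (- s)) in S2; [|auto].
  apply concave_solution_positive in S1; apply concave_solution_positive in S2.
  exists u1, u2; repeat (split; [tauto|]).
  split; [exists 0; split; lra|tauto].
(* Negative solutions are the opposites of concave ones and see [f] on the positive axis. *)
- destruct (two_concave_solutions_sign N f 1) as [lam0 [Hlam0 H]]; auto.
  exists lam0; split; [exact Hlam0|]; intros lam Hlam.
  destruct (H lam Hlam) as [u1 [u2 [S1 [S2 Hlt]]]].
  assert (Hext : forall s, 1 ^ N * f (1 * s) = f s)
    by (intros s; rewrite pow1, !Rmult_1_l; reflexivity).
  apply concave_solution_ext with (g := f) in S1; [|auto].
  apply concave_solution_ext with (g := f) in S2; [|auto].
  apply concave_solution_negative in S1; apply concave_solution_negative in S2.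
  exists (fun x => - u1 x), (fun x => - u2 x); repeat (split; [tauto|]).
  split; [exists 0; split; lra|tauto].
Qed.
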